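(* Let $A$ be a block Jacobi matrix with entries $(a_n)$, $(b_n)$. Assume that there is a sequence $(\alpha_n:n\ge0)$ of bounded linear operators on $\mathcal H$ such that (a) $\displaystyle\sum_{n=1}^\infty\frac{\left\|\left(\mathrm{Re}\left[\alpha_{n+1}a_{n+1}^*-a_n^*a_{n-1}^{-1}\alpha_{n-1}a_n\right]\right)^-\right\|}{\|\alpha_na_n^*\|}<\infty$, (b) $\displaystyle\sum_{n=1}^\infty\frac{\|a_{n-1}^{-1}\alpha_{n-1}a_n-\alpha_n\|}{\|\alpha_na_n^*\|}<\infty$, (c) $\displaystyle\sum_{n=1}^\infty\frac{\|\alpha_nb_{n+1}-b_na_{n-1}^{-1}\alpha_{n-1}a_n\|}{\|\alpha_na_n^*\|}<\infty$, (d) $\displaystyle\sum_{n=0}^\infty\frac1{\|\alpha_na_n^*\|}=\infty$. Let $\Lambda$ be the set of $\lambda\in\mathbb R$ such that the limit \[ C(\lambda)=\lim_{n\to\infty}\frac1{\|\alpha_na_n^*\|}\mathrm{Re}\left[\begin{pmatrix}\alpha_na_n^*&-(\lambda\,\mathrm{Id}-b_n)a_{n-1}^{-1}\alpha_{n-1}a_n\\0&a_n^*a_{n-1}^{-1}\alpha_{n-1}a_n\end{pmatrix}\right] \] exists in the operator norm and defines a strictly positive operator on $\mathcal H\oplus\mathcal H$. Then $\sigma_{\mathrm p}(A^* )\cap\Lambda=\emptyset$ and $\sigma(A^* )\supset\overline\Lambda$.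
   Context: Let $\mathcal H$ be a complex Hilbert space, and let $(a_n:n\ge 0)$, $(b_n:n\ge 0)$ be sequences of bounded linear operators on $\mathcal H$ such that every $a_n$ has a bounded inverse and every $b_n$ is self-adjoint. $\|\cdot\|$ is the operator norm. The formal matrix $\mathcal A$ acts on any sequence $u=(u_n:n\ge0)$ in $\mathcal H$ by $(\mathcal A u)_0=b_0u_0+a_0u_1$ and $(\mathcal A u)_n=a_{n-1}^*u_{n-1}+b_nu_n+a_nu_{n+1}$ for $n\ge1$. The block Jacobi matrix $A$ is the closure in $\ell^2(\mathbb N;\mathcal H)$ ($\mathbb N=\{0,1,2,\dots\}$) of the restriction of $\mathcal A$ to the finitely supported sequences; $A^*$ is its adjoint, $\sigma(A^* )$ the spectrum and $\sigma_{\mathrm p}(A^* )$ the set of eigenvalues of $A^*$. For a bounded operator $X$, $\mathrm{Re}[X]=\frac12(X+X^* )$. For a bounded self-adjoint $X$, $X^-$ is defined through the spectral theorem from the function $x^-=\max(0,-x)$. A bounded self-adjoint operator $X$ is strictly positive if $X\ge c\,\mathrm{Id}$ for some $c>0$. *)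

(* Defs.v *)
From HB Require Import structures.
From mathcomp Require Import all_boot all_order all_algebra complex.
From mathcomp Require Import all_classical all_reals all_analysis.
From mathcomp Require Import ring lra.

Set Implicit Arguments.
Unset Strict Implicit.
Unset Printing Implicit Defensive.
Import Order.TTheory GRing.Theory Num.Theory numFieldNormedType.Exports.

Local Open Scope classical_set_scope.
Local Open Scope complex_scope.
Local Open Scope ring_scope.

HB.mixin Record NormedModule_isPreHilbert (R : realType) H
    & NormedModule R[i] H := {
  dotp : {dot H for @Num.conj R[i]} ;
  dotpxx : forall x : H, dotp x x = `|x| ^+ 2 }.

#[short(type="preHilbertType")]
HB.structure Definition PreHilbert (R : realType) :=
  {H of NormedModule_isPreHilbert R H & NormedModule R[i] H}.

#[short(type="hilbertType")]
HB.structure Definition Hilbert (R : realType) :=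
  {H of PreHilbert R H & CompleteNormedModule R[i] H}.

Section DotNorm.
Variables (C : numClosedFieldType) (U : lmodType C).
Variable form : {dot U for @Num.conj C}.

Lemma dot_conj u v : form v u = Num.conj (form u v).
Proof. by rewrite (hermC form v u) expr0 mul1r. Qed.

Lemma dot_CauchySchwarz u v :
  `|form u v| ^+ 2 <= form u u * form v v.
Proof.
have [->|v0] := eqVneq v 0.
  by rewrite (linear0r form u) (linear0r form 0) normr0 expr0n mulr0.
have vv : 0 < form v v by rewrite dnorm_gt0.
pose w := form v v *: u - form u v *: v.
have : 0 <= form w w by exact: dnorm_ge0.
have -> : form w w = form v v * (form u u * form v v - `|form u v| ^+ 2).
  rewrite dnormB /= !dnormZ (ger0_norm (ltW vv)).
  rewrite (linearZl_LR form) /= (linearZr_LR form) /= !rmorphM /=.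
  rewrite conjCK normCK (conj_Creal (gtr0_real vv)).
  ring.
by rewrite pmulr_rge0// subr_ge0.
Qed.

Lemma sqrt_dnormD u v :
  sqrtC (form (u + v) (u + v)) <= sqrtC (form u u) + sqrtC (form v v).
Proof.
have su := sqrt_dnorm_ge0 form u; have sv := sqrt_dnorm_ge0 form v.
have suv := sqrt_dnorm_ge0 form (u + v).
rewrite -(@ler_pXn2r _ 2)// ?nnegrE ?addr_ge0//.
rewrite sqrrD !sqrtCK dnormD /= [leRHS]addrAC lerD2l.
rewrite -mulr_natr.
have -> : form u v + Num.conj (form u v) = 'Re (form u v) * 2.
  by rewrite ReE divfK// pnatr_eq0.
rewrite ler_pM2r ?ltr0n//.
apply: (le_trans (leif_le (leif_Re_Creal _))).
rewrite -(@ler_pXn2r _ 2)// ?nnegrE ?mulr_ge0//.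
by rewrite exprMn !sqrtCK dot_CauchySchwarz.
Qed.

Lemma sqrt_dnormZ (a : C) u :
  sqrtC (form (a *: u) (a *: u)) = `|a| * sqrtC (form u u).
Proof.
by rewrite dnormZ rootCMl ?exprn_ge0// sqrCK.
Qed.

Lemma sqrt_dnorm_eq0P u : sqrtC (form u u) = 0 -> u = 0.
Proof. by move/eqP; rewrite sqrt_dnorm_eq0 => /eqP. Qed.

End DotNorm.

HB.factory Record Lmodule_isPreHilbert (R : realType) M
    & GRing.Lmodule R[i] M := { form : {dot M for @Num.conj R[i]} }.

HB.builders Context R M & Lmodule_isPreHilbert R M.

HB.instance Definition _ := @Lmodule_isNormed.Build R[i] M
  (fun x => sqrtC (form x x)) (sqrt_dnormD form) (sqrt_dnormZ form)
  (@sqrt_dnorm_eq0P _ _ form).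

Fact form_norm (x : M) : form x x = `|x| ^+ 2.
Proof. by rewrite /Num.norm/= sqrtCK. Qed.

HB.instance Definition _ := NormedModule_isPreHilbert.Build R M form_norm.

HB.end.

(* Not [U * V] itself, whose norm is the maximum norm. *)
Definition hsum (R : realType) (U V : preHilbertType R) : Type := (U * V)%type.

Section HSum.
Variables (R : realType) (U V : preHilbertType R).

HB.instance Definition _ := GRing.Lmodule.copy (hsum U V) (U * V)%type.

Definition hsum_dot (x y : hsum U V) : R[i] := dotp x.1 y.1 + dotp x.2 y.2.

Fact hsum_dot_bilinear :
  bilinear_for *%R (Num.conj \; *%R : R[i] -> R[i] -> R[i]) hsum_dot.
Proof.
split=> [v|u] a x y; rewrite /hsum_dot /=.
  rewrite !(linearDl dotp) /= !(linearZl_LR dotp) /=; ring.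
rewrite !(linearDr dotp) /= !(linearZr_LR dotp) /=; ring.
Qed.

HB.instance Definition _ := bilinear_isBilinear.Build R[i]
  (hsum U V) (hsum U V) R[i] _ _ hsum_dot hsum_dot_bilinear.

Fact hsum_dot_herm x y :
  hsum_dot x y = (-1) ^+ false * Num.conj (hsum_dot y x).
Proof.
by rewrite expr0 mul1r /hsum_dot rmorphD /= -!dot_conj.
Qed.

HB.instance Definition _ := isHermitianSesquilinear.Build R[i] (hsum U V)
  false (@Num.conj R[i]) hsum_dot hsum_dot_herm.

Fact hsum_dot_gt0 x : x != 0 -> 0 < hsum_dot x x.
Proof.
move=> x0; rewrite lt_neqAle addr_ge0 ?dnorm_ge0// andbT eq_sym.
apply: contra x0; rewrite paddr_eq0 ?dnorm_ge0// !dnorm_eq0.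
by case: x => x1 x2 /= /andP[/eqP -> /eqP ->].
Qed.

HB.instance Definition _ :=
  isDotProduct.Build R[i] (hsum U V) hsum_dot hsum_dot_gt0.

HB.instance Definition _ := Lmodule_isPreHilbert.Build R (hsum U V) hsum_dot.

Lemma hsum_dotE (x y : hsum U V) : dotp x y = dotp x.1 y.1 + dotp x.2 y.2.
Proof. by []. Qed.

End HSum.

Definition rnorm (R : realType) (V : normedModType R[i]) (x : V) : R :=
  complex.Re `|x|.

Section RNorm.
Variables (R : realType).

Lemma rnormE (V : normedModType R[i]) (x : V) : (rnorm x)%:C = `|x|.
Proof. by rewrite /rnorm RRe_real// ger0_real. Qed.

Lemma rnorm_ge0 (V : normedModType R[i]) (x : V) : 0 <= rnorm x.
Proof. by rewrite -lecR rnormE normr_ge0. Qed.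

Lemma rnormD (V : normedModType R[i]) (x y : V) : rnorm (x + y) <= rnorm x + rnorm y.
Proof. by rewrite -lecR rmorphD /= !rnormE ler_normD. Qed.

Lemma rnormZ (V : normedModType R[i]) (a : R[i]) (x : V) :
  rnorm (a *: x) = Normc.normc a * rnorm x.
Proof.
have e : (rnorm (a *: x))%:C = (Normc.normc a * rnorm x)%:C by rewrite rmorphM /= !rnormE normrZ.
by case: e.
Qed.

Lemma dotpE (V : preHilbertType R) (x : V) : dotp x x = (rnorm x ^+ 2)%:C.
Proof. by rewrite dotpxx rmorphXn /= rnormE. Qed.

Lemma normc_dotp (V : preHilbertType R) (x y : V) :
  Normc.normc (dotp x y) <= rnorm x * rnorm y.
Proof.
rewrite -lecR rmorphM /= !rnormE.
rewrite -(@ler_pXn2r _ 2)// ?nnegrE ?mulr_ge0//; last exact: (normr_ge0 (dotp x y)).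
by rewrite exprMn -!dotpxx; exact: dot_CauchySchwarz.
Qed.

Lemma Re_dotp (V : preHilbertType R) (x y : V) :
  `|complex.Re (dotp x y)| <= rnorm x ^+ 2 + rnorm y ^+ 2.
Proof.
have nx := rnorm_ge0 x; have ny := rnorm_ge0 y.
have h := normc_dotp x y.
have : `|complex.Re (dotp x y)| <= Normc.normc (dotp x y).
  by rewrite -lecR; exact: normc_ge_Re.
move=> /le_trans; apply; apply: (le_trans h); nra.
Qed.

Lemma Im_dotp (V : preHilbertType R) (x y : V) :
  `|complex.Im (dotp x y)| <= rnorm x ^+ 2 + rnorm y ^+ 2.
Proof.
have -> : complex.Im (dotp x y) = complex.Re (dotp (- 'i *: x) y).
  by rewrite (linearZl_LR dotp) /=; case: (dotp x y) => p q /=; ring.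
apply: le_trans (Re_dotp _ _) _.
have -> // : rnorm (- 'i *: x) = rnorm x.
by rewrite rnormZ /= oppr0 sqrrN expr0n expr1n add0r sqrtr1 mul1r.
Qed.

End RNorm.

Definition square_summable (R : realType) (V : preHilbertType R) :
  {pred nat -> V} := fun u => `[< cvgn (series (fun n => rnorm (u n) ^+ 2)) >].
Arguments square_summable {R} V.

Record ell2 (R : realType) (V : preHilbertType R) : Type :=
  Ell2 { ell2_seq :> nat -> V ; _ : ell2_seq \in square_summable V }.

Section Ell2.
Variables (R : realType) (V : preHilbertType R).
Local Notation l2 := (ell2 V).

Fact square_summable_submod : submod_closed (square_summable V).
Proof.
split.
  apply/asboolP; rewrite (_ : series _ = cst 0); first exact: is_cvg_cst.
  apply/funext => n; rewrite /series /= big1// => i _.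
  by rewrite /rnorm normr0 /= expr0n.
move=> a u v /asboolP su /asboolP sv; apply/asboolP.
pose B := (2 * Normc.normc a ^+ 2) *: series (fun n => rnorm (u n) ^+ 2)
  + 2%R *: series (fun n => rnorm (v n) ^+ 2).
have cB : cvgn B.
  by apply: is_cvgD; apply: is_cvgZr; [exact: su|exact: sv].
apply: (@series_le_cvg _ _
  (fun n => (2 * Normc.normc a ^+ 2) * rnorm (u n) ^+ 2 + 2 * rnorm (v n) ^+ 2)).
- by move=> n; rewrite sqr_ge0.
- move=> n; rewrite -mulrA -mulrDr -exprMn.
  by rewrite mulr_ge0 ?ler0n// addr_ge0 ?sqr_ge0.
- move=> n; have h := rnormD (a *: u n) (v n).
  rewrite rnormZ in h.
  have h0 := rnorm_ge0 (a *: u n + v n).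
  apply: (@le_trans _ _ ((Normc.normc a * rnorm (u n) + rnorm (v n)) ^+ 2)).
    by rewrite ler_pXn2r ?nnegrE// (le_trans h0 h).
  have := sqr_ge0 (Normc.normc a * rnorm (u n) - rnorm (v n)).
  nra.
- rewrite (_ : series _ = B)//; apply/funext => n.
  by rewrite /B /series /= big_split /= -!mulr_sumr.
Qed.

HB.instance Definition _ := [isSub for @ell2_seq R V].
HB.instance Definition _ := [Choice of ell2 V by <:].
HB.instance Definition _ :=
  GRing.isSubmodClosed.Build R[i] (nat -> V) (square_summable V) square_summable_submod.
HB.instance Definition _ := [SubChoice_isSubLmodule of ell2 V by <:].

Lemma ell2_cvg (u : l2) : cvgn (series (fun n => rnorm (u n) ^+ 2)).
Proof. by case: u => u /= /asboolP. Qed.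

Lemma ell2_cvg_Re (u v : l2) :
  cvgn (series (fun n => complex.Re (dotp (u n) (v n)))).
Proof.
apply: normed_cvg; apply: (@series_le_cvg _ _
  (fun n => rnorm (u n) ^+ 2 + rnorm (v n) ^+ 2)) => //=.
- by move=> n; rewrite addr_ge0// sqr_ge0.
- by move=> n; exact: Re_dotp.
- rewrite (_ : series _ = series (fun n => rnorm (u n) ^+ 2)
    + series (fun n => rnorm (v n) ^+ 2)); last first.
    by apply/funext => n; rewrite /series/= big_split.
  by apply: is_cvgD; exact: ell2_cvg.
Qed.

Lemma ell2_cvg_Im (u v : l2) :
  cvgn (series (fun n => complex.Im (dotp (u n) (v n)))).
Proof.
apply: normed_cvg; apply: (@series_le_cvg _ _
  (fun n => rnorm (u n) ^+ 2 + rnorm (v n) ^+ 2)) => //=.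
- by move=> n; rewrite addr_ge0// sqr_ge0.
- by move=> n; exact: Im_dotp.
- rewrite (_ : series _ = series (fun n => rnorm (u n) ^+ 2)
    + series (fun n => rnorm (v n) ^+ 2)); last first.
    by apply/funext => n; rewrite /series/= big_split.
  by apply: is_cvgD; exact: ell2_cvg.
Qed.

(* [R[i]] carries no topology, hence the separate real and imaginary parts. *)
Definition ell2_dot (u v : l2) : R[i] :=
  (limn (series (fun n => complex.Re (dotp (u n) (v n)))))
  +i* (limn (series (fun n => complex.Im (dotp (u n) (v n))))).

Fact ell2_dotC (u v : l2) : ell2_dot u v = Num.conj (ell2_dot v u).
Proof.
rewrite -[RHS]/(conjc (ell2_dot v u)) /ell2_dot /=.
have sw n : dotp (u n) (v n) = conjc (dotp (v n) (u n)) by exact: dot_conj.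
congr (_ +i* _).
  congr (limn (series _)); apply/funext => n.
  by rewrite sw; case: (dotp _ _).
rewrite (_ : series _ = - series (fun n => complex.Im (dotp (v n) (u n)))).
  by rewrite limN//; exact: ell2_cvg_Im.
apply/funext => n; rewrite -[RHS]/(- (series _ n)) /series /= -sumrN.
by apply: eq_bigr => i _; rewrite sw; case: (dotp _ _).
Qed.

Fact ell2_dot_bilinear :
  bilinear_for *%R (Num.conj \; *%R : R[i] -> R[i] -> R[i]) ell2_dot.
Proof.
have key (u v w : l2) (a : R[i]) :
    ell2_dot (a *: u + v) w = a * ell2_dot u w + ell2_dot v w.
  case: a => p q; rewrite /ell2_dot.
  set A := series (fun n => complex.Re (dotp (u n) (w n))).
  set B := series (fun n => complex.Im (dotp (u n) (w n))).
  set A' := series (fun n => complex.Re (dotp (v n) (w n))).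
  set B' := series (fun n => complex.Im (dotp (v n) (w n))).
  have cA : cvgn A by exact: ell2_cvg_Re.
  have cB : cvgn B by exact: ell2_cvg_Im.
  have cA' : cvgn A' by exact: ell2_cvg_Re.
  have cB' : cvgn B' by exact: ell2_cvg_Im.
  rewrite (_ : series _ = (p *: A - q *: B) + A'); last first.
    apply/funext => n; rewrite -[RHS]/(p * A n - q * B n + A' n).
    rewrite /A /B /A' /series /=.
    rewrite !mulr_sumr -sumrB -big_split /=.
    apply: eq_bigr => i _.
    rewrite (linearDl dotp) /= (linearZl_LR dotp) /=.
    by case: (dotp (u i) (w i)) => x y /=; case: (dotp (v i) (w i)).
  rewrite [in X in _ +i* X](_ : series _ = (p *: B + q *: A) + B'); last first.
    apply/funext => n; rewrite -[RHS]/(p * B n + q * A n + B' n).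
    rewrite /A /B /B' /series /=.
    rewrite !mulr_sumr -!big_split /=.
    apply: eq_bigr => i _.
    rewrite (linearDl dotp) /= (linearZl_LR dotp) /=.
    by case: (dotp (u i) (w i)) => x y /=; case: (dotp (v i) (w i)).
  have -> : limn (p *: A - q *: B + A') = p * limn A - q * limn B + limn A'.
    by apply: cvg_lim => //; apply: cvgD => //; apply: cvgB; apply: cvgZr.
  have -> : limn (p *: B + q *: A + B') = p * limn B + q * limn A + limn B'.
    by apply: cvg_lim => //; apply: cvgD => //; apply: cvgD; apply: cvgZr.
  by [].
split=> [v|u] a x y /=; first exact: key.
by rewrite ell2_dotC key rmorphD rmorphM /= -!ell2_dotC.
Qed.

HB.instance Definition _ := bilinear_isBilinear.Build R[i]
  l2 l2 R[i] _ _ ell2_dot ell2_dot_bilinear.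

Fact ell2_dot_herm (u v : l2) :
  ell2_dot u v = (-1) ^+ false * Num.conj (ell2_dot v u).
Proof. by rewrite expr0 mul1r ell2_dotC. Qed.

HB.instance Definition _ := isHermitianSesquilinear.Build R[i] l2
  false (@Num.conj R[i]) ell2_dot ell2_dot_herm.

Fact ell2_dot_gt0 (u : l2) : u != 0 -> 0 < ell2_dot u u.
Proof.
move=> u0.
have eIm : limn (series (fun n => complex.Im (dotp (u n) (u n)))) = 0.
  apply: cvg_lim => //; rewrite (_ : series _ = cst 0); first exact: cvg_cst.
  by apply/funext => n; rewrite /series /= big1// => i _; rewrite dotpE.
have eRe : series (fun n => complex.Re (dotp (u n) (u n)))
    = series (fun n => rnorm (u n) ^+ 2).
  by congr series; apply/funext => n; rewrite dotpE.
rewrite /ell2_dot eIm eRe ltcE /= eqxx /=.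
have [n un0] : exists n, u n != 0.
  apply: contrapT => /forallNP h; move/eqP: u0; apply.
  apply: val_inj; apply/funext => n /=.
  by have /negP := h n; rewrite negbK => /eqP ->.
have nd : nondecreasing_seq (series (fun n => rnorm (u n) ^+ 2)).
  by apply/nondecreasing_seqP => m; rewrite seriesSr lerDl sqr_ge0.
apply: (@lt_le_trans _ _ (series (fun n => rnorm (u n) ^+ 2) n.+1)); last first.
  by apply: nondecreasing_cvgn_le => //; exact: ell2_cvg.
rewrite seriesSr ltr_wpDl//.
  by rewrite /series /= sumr_ge0// => i _; rewrite sqr_ge0.
by rewrite exprn_gt0// -ltcR rnormE normr_gt0.
Qed.

HB.instance Definition _ := isDotProduct.Build R[i] l2 ell2_dot ell2_dot_gt0.

HB.instance Definition _ := Lmodule_isPreHilbert.Build R l2 ell2_dot.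

End Ell2.

Section Operators.
Variables (R : realType) (U V : preHilbertType R).

Definition bounded_op (T : U -> V) : Prop :=
  linear T /\ exists M : R, forall x, rnorm (T x) <= M * rnorm x.

Definition opnorm (T : U -> V) : R :=
  sup [set rnorm (T x) | x in [set x | rnorm x <= 1]].

(* Meaningful for a bounded [T] on a Hilbert space [U]: there, [adj T y] is
   the unique such vector. *)
Definition adj (T : U -> V) (y : V) : U :=
  get [set z | forall x, dotp (T x) y = dotp x z].

(* Meaningful for a bijective [T]. *)
Definition invop (T : U -> V) (y : V) : U := get [set x | T x = y].

End Operators.

Definition boundedly_invertible (R : realType) (U V : preHilbertType R)
    (T : U -> V) : Prop :=
  exists2 S : V -> U, bounded_op S & cancel T S /\ cancel S T.

Section Endomorphisms.
Variables (R : realType) (V : preHilbertType R).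
Implicit Types (T X Y : V -> V) (G : set (V * V)).

Definition selfadjoint X : Prop :=
  bounded_op X /\ forall x y, dotp (X x) y = dotp x (X y).

Definition Reop T : V -> V := 2^-1 *: (T + adj T).

Definition strictly_positive X : Prop :=
  selfadjoint X /\
  exists2 c : R, 0 < c & forall x, 0 <= dotp (X x - c%:C *: x) x.

(* Possibly unbounded operators are represented by their graphs. *)
Definition graph T : set (V * V) := [set p | p.2 = T p.1].

(* The adjoint of a densely defined operator. *)
Definition adj_graph G : set (V * V) :=
  [set p | forall q, G q -> dotp q.2 p.1 = dotp q.1 p.2].

Definition point_spectrum G : set R[i] :=
  [set z | exists2 x : V, x != 0 & G (x, z *: x)].

(* [z] is in the resolvent set when [G - z] has an everywhere defined bounded
   inverse [S]. *)
Definition resolvent_set G : set R[i] :=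
  [set z | exists2 S : V -> V, bounded_op S &
    forall x y, G (x, y + z *: x) <-> x = S y].

Definition spectrum G : set R[i] := ~` resolvent_set G.

Definition poly_op (p : {poly R}) X : V -> V :=
  fun x => \sum_(i < size p) (p`_i)%:C *: iter i X x.

(* Continuous functional calculus of a bounded self-adjoint [X]: [Y] is [f(X)]
   if it is a norm limit of [p_k(X)], where the real polynomials [p_k] converge
   to [f] uniformly on the (real) spectrum of [X]. *)
Definition is_funcalc (f : R -> R) X Y : Prop :=
  bounded_op Y /\
  exists2 p : nat -> {poly R},
    {uniform [set t | spectrum (graph X) t%:C],
      (fun k t => (p k).[t]) @ \oo --> f} &
    opnorm (poly_op (p k) X - Y) @[k --> \oo] --> (0 : R).

Definition funcalc (f : R -> R) X : V -> V := get (is_funcalc f X).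

Definition negpart X : V -> V := funcalc (fun t => Num.max 0 (- t)) X.

End Endomorphisms.

Definition block_op (R : realType) (U V : preHilbertType R)
    (T11 : U -> U) (T12 : V -> U) (T21 : U -> V) (T22 : V -> V) :
    hsum U V -> hsum U V :=
  fun x => (T11 x.1 + T12 x.2, T21 x.1 + T22 x.2).

Section BlockJacobi.
Variables (R : realType) (H : hilbertType R).
Variables (a b alpha : nat -> H -> H).

Definition formal_jacobi (u : nat -> H) (n : nat) : H :=
  if n is m.+1
  then adj (a m) (u m) + b m.+1 (u m.+1) + a m.+1 (u m.+2)
  else b 0 (u 0) + a 0 (u 1).

Definition jacobi_finite : set (ell2 H * ell2 H) :=
  [set p : ell2 H * ell2 H | (exists N, forall n, (N <= n)%N -> p.1 n = 0) /\
           forall n, p.2 n = formal_jacobi p.1 n].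

Definition jacobi : set (ell2 H * ell2 H) := closure jacobi_finite.

(* [a_(n-1)^-1 alpha_(n-1) a_n]; only meaningful for [0 < n]. *)
Definition conj_alpha (n : nat) : H -> H :=
  invop (a n.-1) \o alpha n.-1 \o a n.

Definition weight (n : nat) : R := opnorm (alpha n \o adj (a n)).

Definition lambda_block (lambda : R) (n : nat) : hsum H H -> hsum H H :=
  block_op (alpha n \o adj (a n))
           (- ((lambda%:C *: (id : H -> H) - b n) \o conj_alpha n))
           0
           (adj (a n) \o conj_alpha n).

Definition Lambda : set R :=
  [set lambda | exists2 C : hsum H H -> hsum H H,
     opnorm ((weight n)^-1%:C *: Reop (lambda_block lambda n) - C) @[n --> \oo]
       --> (0 : R) &
     strictly_positive C].

End BlockJacobi.

(* Main.v *)
Require Import Defs.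
From HB Require Import structures.
From mathcomp Require Import all_boot all_order all_algebra complex.
From mathcomp Require Import all_classical all_reals all_analysis.
From mathcomp Require Import ring lra.
Import Order.TTheory GRing.Theory Num.Theory numFieldNormedType.Exports.
Local Open Scope classical_set_scope.
Local Open Scope complex_scope.
Local Open Scope ring_scope.

(** The proof follows a generalized eigenvector [u], that is a solution of
    [a_(n-1)^* u_(n-1) + b_n u_n + a_n u_(n+1) = l u_n] for [n >= 1], through
    the real numbers [S_n], the quadratic form at [(u_n, u_(n+1))] of the
    operator whose normalized limit defines [C(l)].

    If [l] is in [Lambda], then for large [n] the number [S_n] lies between two
    positive multiples of [w_n (|u_n|^2 + |u_(n+1)|^2)], where [w_n] is the norm
    of [alpha_n a_n^*] ([Lambda_block_form]). The recurrence rewrites [S_n] as a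
    Turan-type determinant of three consecutive terms ([block_form_turan]), and
    with it [S_(n+1) - S_n] becomes a sum of three terms governed by the
    operators of assumptions (a), (b) and (c) ([block_form_step]). Relative to
    [S_n] the possible decrease is therefore summable, so either some [S_n]
    vanishes, and then [u = 0] by running the recurrence both ways, or [S_n]
    stays above a positive constant. In the second case
    [|u_n|^2 + |u_(n+1)|^2] dominates a multiple of [1 / w_n], whose sum
    diverges, and [u] is not square summable ([summable_vanish]). Hence a
    square-summable [u] is zero ([generalized_eigenvector_eq0]).

    The adjoint [A^*] acts as the formal matrix ([adj_graph_jacobi]), so there
    is no eigenvalue in [Lambda]. If [l] in [Lambda] were in the resolvent set,
    the solution of [(A^* - l) u = f] with [f] supported at index 0 would be a
    generalized eigenvector in the above sense, so [u = 0] and [f = 0]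
    ([Lambda_not_resolvent]). The closure of [Lambda] is covered because the
    resolvent set is open ([resolvent_set_open]).

    Three facts of operator theory support this: adjoints of bounded operators
    exist (Riesz representation, [riesz]); the Neumann series converges, in [H]
    and in [ell2 H] ([neumann], [ell2_seq_complete]); and a self-adjoint [X]
    satisfies [X >= - |X^-|] ([negpart_ge]), where [X^-] is defined by the
    continuous functional calculus. Its existence for the function [t^-] comes
    from an explicit polynomial iteration for the absolute value
    ([funcalc_negpart_ex]). *)

Set Implicit Arguments.
Unset Strict Implicit.
Unset Printing Implicit Defensive.

(** * The real part of the inner product *)

Section RealInnerProduct.
Variables (R : realType) (V : preHilbertType R).
Implicit Types (x y z : V) (r s : R).

(** Every estimate below is about real parts, so the argument runs in this
    real bilinear form; [dotp_rdot] recovers the complex one. *)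
Definition rdot x y : R := complex.Re (dotp x y).

Lemma rdotC x y : rdot x y = rdot y x.
Proof. by rewrite /rdot (dot_conj dotp y x); case: (dotp y x). Qed.

Lemma rdotDl x y z : rdot (x + y) z = rdot x z + rdot y z.
Proof. by rewrite /rdot (linearDl dotp) /=; case: (dotp x z); case: (dotp y z). Qed.

Lemma rdotNl x z : rdot (- x) z = - rdot x z.
Proof. by rewrite /rdot (linearNl dotp) /=; case: (dotp x z). Qed.

Lemma rdotBl x y z : rdot (x - y) z = rdot x z - rdot y z.
Proof. by rewrite rdotDl rdotNl. Qed.

Lemma rdotZl r x z : rdot (r%:C *: x) z = r * rdot x z.
Proof. by rewrite /rdot (linearZl_LR dotp) /=; case: (dotp x z) => p q /=; ring. Qed.

Lemma rdot0l x : rdot 0 x = 0.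
Proof. by rewrite -[0](subrr 0) rdotBl subrr. Qed.

Lemma rdotDr x y z : rdot x (y + z) = rdot x y + rdot x z.
Proof. by rewrite rdotC rdotDl !(rdotC x). Qed.

Lemma rdotNr x z : rdot x (- z) = - rdot x z.
Proof. by rewrite rdotC rdotNl rdotC. Qed.

Lemma rdotBr x y z : rdot x (y - z) = rdot x y - rdot x z.
Proof. by rewrite rdotDr rdotNr. Qed.

Lemma rdotZr r x z : rdot x (r%:C *: z) = r * rdot x z.
Proof. by rewrite rdotC rdotZl rdotC. Qed.

Lemma rdot0r x : rdot x 0 = 0.
Proof. by rewrite rdotC rdot0l. Qed.

Definition rdotE := (rdotDl, rdotDr, rdotNl, rdotNr, rdotZl, rdotZr, rdot0l, rdot0r).

Lemma rdotxx x : rdot x x = rnorm x ^+ 2.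
Proof. by rewrite /rdot dotpE. Qed.

Lemma dotp_rdot x y : dotp x y = rdot x y +i* rdot (- 'i *: x) y.
Proof.
rewrite /rdot (linearZl_LR dotp) /=; case: (dotp x y) => p q /=.
by congr (_ +i* _); ring.
Qed.

Lemma rdot_le x y : `|rdot x y| <= rnorm x * rnorm y.
Proof.
apply: le_trans (normc_dotp x y).
by rewrite -lecR; exact: normc_ge_Re.
Qed.

Lemma rdot_ler x y : rdot x y <= rnorm x * rnorm y.
Proof. exact: le_trans (ler_norm _) (rdot_le _ _). Qed.

Lemma rnorm0 : rnorm (0 : V) = 0.
Proof. by rewrite /rnorm normr0. Qed.

Lemma rnorm_eq0 x : (rnorm x == 0) = (x == 0).
Proof.
apply/eqP/eqP => [x0|->]; last exact: rnorm0.
by apply/normr0_eq0; rewrite -rnormE x0.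
Qed.

Lemma rnorm_gt0 x : (0 < rnorm x) = (x != 0).
Proof. by rewrite lt_neqAle rnorm_ge0 andbT eq_sym rnorm_eq0. Qed.

Lemma rnormN x : rnorm (- x) = rnorm x.
Proof. by rewrite /rnorm normrN. Qed.

Lemma rnormB x y : rnorm (x - y) = rnorm (y - x).
Proof. by rewrite -rnormN opprB. Qed.

Lemma rnorm_sub_le x y : rnorm (x - y) <= rnorm x + rnorm y.
Proof. by rewrite -(rnormN y) rnormD. Qed.

Lemma rnormZr r x : rnorm (r%:C *: x) = `|r| * rnorm x.
Proof. by rewrite rnormZ /= expr0n addr0 sqrtr_sqr. Qed.

Lemma rnorm_triangle y x z : rnorm (x - z) <= rnorm (x - y) + rnorm (y - z).
Proof. by rewrite -[x - z](subrKA y) rnormD. Qed.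

Lemma ler_rnorm_sub x y : rnorm x - rnorm y <= rnorm (x - y).
Proof. by rewrite lerBlDr; have := rnormD (x - y) y; rewrite subrK. Qed.

Lemma rdot_inj y z : (forall x, rdot x y = rdot x z) -> y = z.
Proof.
move=> h; apply/eqP; rewrite -subr_eq0 -rnorm_eq0 -sqrf_eq0 -rdotxx.
by rewrite rdotBr h subrr.
Qed.

Lemma rnorm_sqr_inj x : rnorm x ^+ 2 = 0 -> x = 0.
Proof. by move/eqP; rewrite sqrf_eq0 rnorm_eq0 => /eqP. Qed.

End RealInnerProduct.

(** * Completeness and the Riesz representation *)

Section Completeness.
Variables (R : realType).

(** Sequential completeness expressed with the real-valued norm, so that one
    notion covers [H], [hsum H H] and [ell2 H]. *)
Definition seq_complete (V : preHilbertType R) := forall u : nat -> V,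
  (forall e : R, 0 < e -> exists N, forall m n, (N <= m)%N -> (N <= n)%N ->
     rnorm (u m - u n) < e) ->
  exists l, rnorm (u n - l) @[n --> \oo] --> (0 : R).

Lemma hilbert_seq_complete (H : hilbertType R) : seq_complete H.
Proof.
move=> u cu.
have /cauchy_cvgP/cvg_ex[l ul] : cauchy (u @ \oo).
  apply/cauchy_ballP => e e0.
  have [e0' eE] : 0 < complex.Re e /\ e = (complex.Re e)%:C.
    by case: e e0 => p q; rewrite ltcE /= => /andP[/eqP -> ->].
  have [N hN] := cu _ e0'.
  pose B := u @` [set n | (N <= n)%N].
  exists (B, B) => /=.
    by split; exists N => // n Nn; exists n.
  move=> [_ _] /= [[m Nm <-] [n Nn <-]]; rewrite -ball_normE /=.
  by rewrite eE -rnormE ltcR hN.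
exists l; apply/cvgrPdist_lt => e e0; move/cvgrPdist_lt : ul => /(_ e%:C).
rewrite ltcR => /(_ e0); apply: filterS => n.
by rewrite -rnormE ltcR sub0r normrN ger0_norm ?rnorm_ge0// rnormB.
Qed.

End Completeness.

(** Riesz representation for real-linear functionals, by minimizing
    [|x|^2 - 2 f x]: the parallelogram identity makes every minimizing
    sequence Cauchy, and its limit satisfies the first-order condition. *)
Lemma riesz (R : realType) (V : preHilbertType R) (cV : seq_complete V)
    (f : V -> R) (M : R) :
  (forall x y, f (x + y) = f x + f y) ->
  (forall (r : R) x, f (r%:C *: x) = r * f x) ->
  (forall x, f x <= M * rnorm x) ->
  exists z, forall x, f x = rdot x z.
Proof.
move=> fD fZ fM.
pose J x := rnorm x ^+ 2 - f x *+ 2.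
have JM x : - M ^+ 2 <= J x.
  by rewrite /J; have := fM x; have := sqr_ge0 (rnorm x - M); nra.
pose A := range J.
have iA : has_inf A.
  by split; [exists (J 0), 0|exists (- M ^+ 2) => _ [x _ <-]].
pose d := inf A.
have Jd x : d <= J x by apply: ge_inf; [exact: iA.2|exists x].
have ex n : exists x, J x < d + n.+1%:R^-1.
  have [_ [x _ <-] ?] := inf_adherent (ltac:(by rewrite invr_gt0 ltr0n) : 0 < n.+1%:R^-1 :> R) iA.
  by exists x.
pose x_ n := projT1 (cid (ex n)).
have x_P n : J (x_ n) < d + n.+1%:R^-1 by rewrite /x_; case: cid.
(* parallelogram identity, with [J] evaluated at the midpoint *)
have par m n : rnorm (x_ m - x_ n) ^+ 2 <= (m.+1%:R^-1 + n.+1%:R^-1) *+ 2.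
  have := x_P m; have := x_P n; have := Jd ((2^-1)%:C *: (x_ m + x_ n)).
  rewrite /J fZ fD -!rdotxx !rdotE (rdotC (x_ n) (x_ m)).
  move: (n.+1%:R^-1) (m.+1%:R^-1) => p q h1 h2 h3.
  move: h1 h2 h3; lra.
have cinv : (n.+1%:R^-1 : R) @[n --> \oo] --> (0 : R) by exact: cvg_harmonic.
have [l xl] : exists l, rnorm (x_ n - l) @[n --> \oo] --> (0 : R).
  apply: cV => e e0.
  have e4 : 0 < e ^+ 2 / 4 by rewrite divr_gt0 ?exprn_gt0.
  move/cvgrPdist_lt : cinv => /(_ _ e4) [N _ hN]; exists N => m n Nm Nn.
  have := hN _ Nm; have := hN _ Nn; rewrite /= !sub0r !normrN !ger0_norm// => h1 h2.
  rewrite -(@ltr_pXn2r _ 2) ?nnegrE ?rnorm_ge0// ?ltW//.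
  apply: le_lt_trans (par m n) _; move: h1 h2.
  by move: (m.+1%:R^-1) (n.+1%:R^-1) => p q; lra.
(* [J (x_ n + t h)] is nearly minimal at [t = 0], so its derivative there,
   twice [<h, x_ n> - f h], tends to 0 *)
exists l => h; apply/eqP; rewrite -subr_eq0; apply/eqP.
pose c := rnorm h ^+ 2 + 1.
have c0 : 0 < c by rewrite /c; have := sqr_ge0 (rnorm h); lra.
have Ale n : (rdot h (x_ n) - f h) ^+ 2 <= c * n.+1%:R^-1.
  set a := _ - _; pose t := - a / c.
  have := x_P n; have := Jd (x_ n + t%:C *: h).
  rewrite /J fD fZ -!rdotxx !rdotE (rdotC (x_ n) h) !rdotxx => h1 h2.
  have h3 : - n.+1%:R^-1 <= t ^+ 2 * rnorm h ^+ 2 + (t * a) *+ 2.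
    by rewrite /a; move: h1 h2; move: (n.+1%:R^-1) => p; lra.
  have h4 : t ^+ 2 * rnorm h ^+ 2 <= t ^+ 2 * c.
    by rewrite ler_wpM2l ?sqr_ge0// /c lerDl.
  have h5 : t ^+ 2 * c = a ^+ 2 / c by rewrite /t; field; rewrite gt_eqF.
  have h6 : t * a = - (a ^+ 2 / c) by rewrite /t; field; rewrite gt_eqF.
  have : a ^+ 2 / c <= n.+1%:R^-1 by rewrite h5 h6 in h3 h4; move: h3 h4; move: (n.+1%:R^-1) (a ^+ 2 / c) => p q; lra.
  by rewrite ler_pdivrMr// mulrC.
have lim1 : (rdot h (x_ n) - f h) @[n --> \oo] --> rdot h l - f h.
  apply: cvgB; last exact: cvg_cst.
  have {xl} : rnorm h * rnorm (x_ n - l) @[n --> \oo] --> (0 : R).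
    by rewrite -[0](mulr0 (rnorm h)); apply: cvgMr.
  move/cvgrPdist_le => xl; apply/cvgrPdist_le => e /xl; apply: filterS => n.
  rewrite sub0r normrN ger0_norm ?mulr_ge0 ?rnorm_ge0// => /(le_trans _); apply.
  by rewrite -rdotBr; apply: le_trans (rdot_le _ _) _; rewrite rnormB.
have lim2 : (rdot h (x_ n) - f h) ^+ 2 @[n --> \oo] --> (0 : R).
  apply: (@squeeze_cvgr _ _ _ _ (fun=> 0) (fun n => c * n.+1%:R^-1)).
  - by near=> n; rewrite sqr_ge0 Ale.
  - exact: cvg_cst.
  - by rewrite -[0](mulr0 c); apply: cvgMr.
have lim3 : (rdot h (x_ n) - f h) ^+ 2 @[n --> \oo] --> (rdot h l - f h) ^+ 2.
  exact: (cvgM lim1 lim1).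
have /eqP : (rdot h l - f h) ^+ 2 = 0.
  by rewrite -(cvg_lim (@Rhausdorff R) lim3); apply: (cvg_lim (@Rhausdorff R)).
by rewrite sqrf_eq0 => /eqP h0; rewrite -opprB h0 oppr0.
Unshelve. all: by end_near.
Qed.

(** * Bounded operators and their adjoints *)

Section BoundedOperators.
Variables (R : realType) (U V : preHilbertType R).
Implicit Types (S T : U -> V).

Lemma linear_op0 T : linear T -> T 0 = 0.
Proof. by move=> l; have := l (-1) 0 0; rewrite scaler0 addr0 scaleN1r addNr. Qed.

Lemma linear_opD T x y : linear T -> T (x + y) = T x + T y.
Proof. by move=> l; have := l 1 x y; rewrite !scale1r. Qed.

Lemma linear_opZ T a x : linear T -> T (a *: x) = a *: T x.
Proof. by move=> l; have := l a x 0; rewrite (linear_op0 l) !addr0. Qed.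

Lemma linear_opN T x : linear T -> T (- x) = - T x.
Proof. by move=> l; rewrite -scaleN1r linear_opZ// scaleN1r. Qed.

Lemma linear_opB T x y : linear T -> T (x - y) = T x - T y.
Proof. by move=> l; rewrite linear_opD// linear_opN. Qed.

Lemma bounded_op_ex T : bounded_op T ->
  exists2 M : R, 0 <= M & forall x, rnorm (T x) <= M * rnorm x.
Proof.
move=> [_ [M hM]]; exists `|M| => // x; apply: le_trans (hM x) _.
by rewrite ler_wpM2r ?rnorm_ge0// ler_norm.
Qed.

Lemma opnorm_le T (M : R) : 0 <= M -> (forall x, rnorm (T x) <= M * rnorm x) ->
  opnorm T <= M.
Proof.
move=> M0 hM; apply: ge_sup.
  by exists (rnorm (T 0)), 0 => //=; rewrite rnorm0.
move=> _ [x /= x1 <-]; apply: le_trans (hM x) _.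
by rewrite -[leRHS]mulr1 ler_wpM2l.
Qed.

Lemma opnormP T x : bounded_op T -> rnorm (T x) <= opnorm T * rnorm x.
Proof.
move=> bT; have [M M0 hM] := bounded_op_ex bT; have [lT _] := bT.
have [->|x0] := eqVneq x 0; first by rewrite linear_op0// !rnorm0 mulr0.
have nx : 0 < rnorm x by rewrite rnorm_gt0.
have bd : has_ubound [set rnorm (T x) | x in [set x | rnorm x <= 1]].
  exists M => _ [y /= y1 <-]; apply: le_trans (hM y) _.
  by rewrite -[leRHS]mulr1 ler_wpM2l.
have : rnorm (T ((rnorm x)^-1%:C *: x)) <= opnorm T.
  apply: ub_le_sup => //; exists ((rnorm x)^-1%:C *: x) => //=.
  by rewrite rnormZr ger0_norm ?invr_ge0 ?rnorm_ge0// mulVf// gt_eqF.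
rewrite linear_opZ// rnormZr ger0_norm ?invr_ge0 ?rnorm_ge0//.
by rewrite ler_pdivrMl// mulrC.
Qed.

Lemma opnorm_ge0 T : bounded_op T -> 0 <= opnorm T.
Proof.
move=> bT; have [M M0 hM] := bounded_op_ex bT; have [lT _] := bT.
apply: ub_le_sup.
  exists M => _ [y /= y1 <-]; apply: le_trans (hM y) _.
  by rewrite -[leRHS]mulr1 ler_wpM2l.
by exists 0; rewrite /= ?linear_op0// ?rnorm0.
Qed.

Lemma rdot_opnorm T x y : bounded_op T ->
  `|rdot (T x) y| <= opnorm T * rnorm x * rnorm y.
Proof.
move=> bT; apply: le_trans (rdot_le _ _) _.
by rewrite ler_wpM2r ?rnorm_ge0// opnormP.
Qed.

Lemma bounded_op0 : bounded_op (0 : U -> V).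
Proof.
split; first by move=> a x y; rewrite /= scaler0 addr0.
by exists 0 => x; rewrite rnorm0 mul0r.
Qed.

Lemma bounded_opD S T : bounded_op S -> bounded_op T -> bounded_op (S + T).
Proof.
move=> [lS [M hM]] [lT [N hN]]; split.
  by move=> a x y; rewrite -[LHS]/(S _ + T _) lS lT -[(S + T) x]/(S x + T x)
    -[(S + T) y]/(S y + T y) scalerDr addrACA.
exists (M + N) => x; apply: le_trans (rnormD _ _) _.
by rewrite mulrDl lerD.
Qed.

Lemma bounded_opZ (a : R[i]) T : bounded_op T -> bounded_op (a *: T).
Proof.
move=> [lT [M hM]]; split.
  by move=> c x y; rewrite -[LHS]/(a *: T _) lT -[(a *: T) x]/(a *: T x)
    -[(a *: T) y]/(a *: T y) scalerDr !scalerA mulrC.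
exists (Normc.normc a * M) => x; rewrite -[X in rnorm X]/(a *: T x) rnormZ -mulrA.
by rewrite ler_wpM2l//; case: a => p q; exact: sqrtr_ge0.
Qed.

Lemma bounded_opN T : bounded_op T -> bounded_op (- T).
Proof. by move=> bT; rewrite -scaleN1r; exact: bounded_opZ. Qed.

Lemma bounded_opB S T : bounded_op S -> bounded_op T -> bounded_op (S - T).
Proof. by move=> bS bT; apply: bounded_opD => //; exact: bounded_opN. Qed.

End BoundedOperators.

Lemma bounded_op_comp (R : realType) (U V W : preHilbertType R)
    (S : V -> W) (T : U -> V) :
  bounded_op S -> bounded_op T -> bounded_op (S \o T).
Proof.
move=> bS bT; have [M M0 hM] := bounded_op_ex bS; have [N N0 hN] := bounded_op_ex bT.
split; first by move=> a x y /=; rewrite bT.1 bS.1.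
exists (M * N) => x /=; apply: le_trans (hM _) _.
by rewrite -mulrA ler_wpM2l.
Qed.

Lemma bounded_op_id (R : realType) (U : preHilbertType R) : bounded_op (id : U -> U).
Proof. by split=> //; exists 1 => x; rewrite mul1r. Qed.

Lemma rnorm_hsum (R : realType) (U V : preHilbertType R) (x : hsum U V) :
  rnorm x ^+ 2 = rnorm x.1 ^+ 2 + rnorm x.2 ^+ 2.
Proof. by rewrite -!rdotxx /rdot hsum_dotE !dotpE. Qed.

Lemma rdot_hsum (R : realType) (U V : preHilbertType R) (x y : hsum U V) :
  rdot x y = rdot x.1 y.1 + rdot x.2 y.2.
Proof. by rewrite /rdot hsum_dotE; case: (dotp x.1 _); case: (dotp x.2 _). Qed.

Lemma rnorm_fst_le (R : realType) (U V : preHilbertType R) (x : hsum U V) :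
  rnorm x.1 <= rnorm x.
Proof. by rewrite -(@ler_pXn2r _ 2) ?nnegrE ?rnorm_ge0// rnorm_hsum lerDl sqr_ge0. Qed.

Lemma rnorm_snd_le (R : realType) (U V : preHilbertType R) (x : hsum U V) :
  rnorm x.2 <= rnorm x.
Proof. by rewrite -(@ler_pXn2r _ 2) ?nnegrE ?rnorm_ge0// rnorm_hsum lerDr sqr_ge0. Qed.

Lemma rnorm_hsum_le (R : realType) (U V : preHilbertType R) (x : hsum U V) :
  rnorm x <= rnorm x.1 + rnorm x.2.
Proof.
rewrite -(@ler_pXn2r _ 2) ?nnegrE ?addr_ge0 ?rnorm_ge0// rnorm_hsum.
by rewrite sqrrD addrAC lerDl mulrn_wge0// mulr_ge0 ?rnorm_ge0.
Qed.

Lemma hsum_seq_complete (R : realType) (U V : preHilbertType R) :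
  seq_complete U -> seq_complete V -> seq_complete (hsum U V).
Proof.
move=> cU cV u cu.
have [l1 h1] : exists l, rnorm ((u n).1 - l) @[n --> \oo] --> (0 : R).
  apply: cU => e /cu [N hN]; exists N => m n Nm Nn.
  exact: le_lt_trans (rnorm_fst_le (u m - u n)) (hN _ _ Nm Nn).
have [l2 h2] : exists l, rnorm ((u n).2 - l) @[n --> \oo] --> (0 : R).
  apply: cV => e /cu [N hN]; exists N => m n Nm Nn.
  exact: le_lt_trans (rnorm_snd_le (u m - u n)) (hN _ _ Nm Nn).
exists ((l1, l2) : hsum U V).
apply: (@squeeze_cvgr _ _ _ _ (fun=> 0)
  (fun n => rnorm ((u n).1 - l1) + rnorm ((u n).2 - l2))).
- apply: nearW => n; rewrite rnorm_ge0 /=.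
  exact: (rnorm_hsum_le (u n - ((l1, l2) : hsum U V))).
- exact: cvg_cst.
- by rewrite -[0](addr0 0); exact: cvgD.
Qed.

Section Adjoint.
Variables (R : realType) (U V : preHilbertType R).
Hypothesis cU : seq_complete U.
Implicit Types (T : U -> V).

Lemma adjP T x y : bounded_op T -> dotp (T x) y = dotp x (adj T y).
Proof.
move=> bT; have [M M0 hM] := bounded_op_ex bT; have [lT _] := bT.
suff : [set z | forall x, dotp (T x) y = dotp x z] (adj T y) by apply.
apply: getPex.
have [|||z hz] := riesz cU (f := fun x => rdot (T x) y) (M := M * rnorm y).
- by move=> u v; rewrite linear_opD// rdotDl.
- by move=> r u; rewrite linear_opZ// rdotZl.
- move=> u; apply: le_trans (rdot_ler _ _) _.
  by rewrite mulrAC ler_wpM2r ?rnorm_ge0.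
by exists z => u /=; rewrite !dotp_rdot -linear_opZ// !hz.
Qed.

Lemma rdot_adj T x y : bounded_op T -> rdot (T x) y = rdot x (adj T y).
Proof. by move=> bT; rewrite /rdot (adjP _ _ bT). Qed.

Lemma adj_bounded T : bounded_op T -> bounded_op (adj T).
Proof.
move=> bT; have [M M0 hM] := bounded_op_ex bT; split.
  move=> a x y; apply: rdot_inj => z; congr complex.Re.
  rewrite -(adjP _ _ bT) (linearDr dotp) (linearZr_LR dotp) /= !(adjP _ _ bT).
  by rewrite (linearDr dotp) (linearZr_LR dotp).
(* [|adj T y|^2 = <T (adj T y), y>] *)
exists M => y; have [->|h] := eqVneq (adj T y) 0.
  by rewrite rnorm0 mulr_ge0 ?rnorm_ge0.
have n0 : 0 < rnorm (adj T y) by rewrite rnorm_gt0.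
rewrite -(ler_pM2l n0) -expr2 -rdotxx -rdot_adj//.
apply: le_trans (rdot_ler _ _) _.
by rewrite mulrA (mulrC _ M) ler_wpM2r ?rnorm_ge0.
Qed.

End Adjoint.

Section SelfAdjoint.
Variables (R : realType) (V : preHilbertType R).
Hypothesis cV : seq_complete V.
Implicit Types (T : V -> V).

Lemma Reop_selfadjoint T : bounded_op T -> selfadjoint (Reop T).
Proof.
move=> bT; have bA := adj_bounded cV bT.
split; first by apply: bounded_opZ; exact: bounded_opD.
move=> x y; rewrite /Reop -[X in dotp X y]/(2^-1 *: (T x + adj T x)).
rewrite -[X in dotp x X]/(2^-1 *: (T y + adj T y)).
rewrite (linearZl_LR dotp) (linearZr_LR dotp) /= (linearDl dotp) (linearDr dotp) /=.
have -> : dotp (adj T x) y = dotp x (T y).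
  by rewrite (dot_conj dotp y (adj T x)) -(adjP cV _ _ bT) -dot_conj.
have -> : Num.conj (2^-1 : R[i]) = 2^-1 by apply: conj_Creal; rewrite realV realn.
by rewrite (adjP cV _ _ bT) addrC.
Qed.

Lemma rdot_Reop T x : bounded_op T -> rdot (Reop T x) x = rdot (T x) x.
Proof.
move=> bT; rewrite /Reop -[X in rdot X x]/(2^-1 *: (T x + adj T x)).
have -> : 2^-1 = (2^-1 : R)%:C by rewrite fmorphV rmorph_nat.
rewrite !rdotE (rdotC (adj T x)) -(rdot_adj cV _ _ bT).
by rewrite -mulr2n -[X in _ * X]mulr_natl mulKf// pnatr_eq0.
Qed.

End SelfAdjoint.

(** * Neumann series and resolvents *)

Section Neumann.
Variables (R : realType) (V : preHilbertType R).
Hypothesis cV : seq_complete V.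

Lemma cvg0_ltP (u : nat -> R) : (forall n, 0 <= u n) ->
  u n @[n --> \oo] --> (0 : R) <->
  forall e, 0 < e -> exists N, forall n, (N <= n)%N -> u n < e.
Proof.
move=> u0; split.
  move/cvgrPdist_lt => h e /h [N _ hN]; exists N => n /hN /=.
  by rewrite sub0r normrN ger0_norm.
move=> h; apply/cvgrPdist_lt => e /h [N hN]; exists N => // n /= /hN.
by rewrite sub0r normrN ger0_norm.
Qed.

(** By telescoping. The explicit error bound is what turns pointwise limits of
    operators into limits in operator norm. *)
Lemma seq_complete_telescope (u : nat -> V) (s : nat -> R) (L : R) :
  (forall n, rnorm (u n.+1 - u n) <= s n.+1 - s n) ->
  s n @[n --> \oo] --> L ->
  exists2 l, rnorm (u n - l) @[n --> \oo] --> (0 : R) &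
    forall n, rnorm (u n - l) <= L - s n.
Proof.
move=> us sL.
have sd : nondecreasing_seq s.
  by apply/nondecreasing_seqP => n; rewrite -subr_ge0; apply: le_trans (us n); exact: rnorm_ge0.
have sle n : s n <= L.
  by rewrite -(cvg_lim (@Rhausdorff R) sL); apply: nondecreasing_cvgn_le => //; apply/cvg_ex; exists L.
have tel n k : rnorm (u (n + k)%N - u n) <= s (n + k)%N - s n.
  elim: k => [|k ih]; first by rewrite addn0 !subrr rnorm0.
  rewrite addnS; apply: le_trans (rnorm_triangle (u (n + k)%N) _ _) _.
  by have := us (n + k)%N; move: ih; lra.
have tel' n m : (n <= m)%N -> rnorm (u m - u n) <= L - s n.
  by move=> nm; have := tel n (m - n)%N; rewrite subnKC// => /le_trans; apply; rewrite lerD2r.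
have [l hl] : exists l, rnorm (u n - l) @[n --> \oo] --> (0 : R).
  apply: cV => e e0.
  have e2 : 0 < e / 2 by rewrite divr_gt0.
  move/cvgrPdist_lt : sL => /(_ _ e2) [N _ hN]; exists N => m n Nm Nn.
  apply: le_lt_trans (rnorm_triangle (u N) _ _) _.
  have := hN N (leqnn N); rewrite /= ger0_norm ?subr_ge0// => h.
  have := tel' _ _ Nm; have := tel' _ _ Nn; rewrite (rnormB (u n)).
  by move: h; lra.
exists l => // n; apply/ler_addgt0Pr => e e0.
move/(cvg0_ltP (fun n => rnorm_ge0 (u n - l))) : (hl) => /(_ _ e0) [N hN].
apply: le_trans (rnorm_triangle (u (maxn n N)) _ _) _.
rewrite rnormB lerD ?tel' ?leq_maxl//.
by apply/ltW/hN; rewrite leq_maxr.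
Qed.

(** The Neumann series, summed by the iteration [x |-> y + T x]. *)
Lemma neumann (T : V -> V) (q : R) : linear T -> 0 <= q -> q < 1 ->
  (forall x, rnorm (T x) <= q * rnorm x) ->
  exists2 S : V -> V, bounded_op S & forall x y, x - T x = y <-> x = S y.
Proof.
move=> lT q0 q1 Tq.
have q1' : 0 < 1 - q by rewrite subr_gt0.
have bd x : (1 - q) * rnorm x <= rnorm (x - T x).
  rewrite mulrBl mul1r; apply: le_trans (ler_rnorm_sub _ _).
  by rewrite lerD2l lerN2.
have inj x y : x - T x = y - T y -> x = y.
  move=> h; apply/eqP; rewrite -subr_eq0 -rnorm_eq0 eq_le rnorm_ge0 andbT.
  rewrite -(ler_pM2l q1') mulr0; apply: le_trans (bd _) _.
  by rewrite linear_opB// opprD addrACA -opprD h subrr rnorm0.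
have ex y : exists x, x - T x = y.
  pose u n := iter n (fun x => y + T x) 0.
  have us n : rnorm (u n.+1 - u n) <= q ^+ n * rnorm y.
    elim: n => [|n ih]; first by rewrite /u /= linear_op0// addr0 subr0 expr0 mul1r.
    rewrite -[u n.+2]/(y + T (u n.+1)) -[X in _ - X]/(y + T (u n)).
    rewrite opprD addrACA subrr add0r -linear_opB//.
    by apply: le_trans (Tq _) _; rewrite exprS -mulrA ler_wpM2l.
  pose s n := (1 - q ^+ n) / (1 - q) * rnorm y.
  have ss n : rnorm (u n.+1 - u n) <= s n.+1 - s n.
    apply: le_trans (us n) _; rewrite le_eqVlt; apply/orP; left; apply/eqP.
    by rewrite /s exprS; field; rewrite gt_eqF.
  have sc : s n @[n --> \oo] --> (1 - 0) / (1 - q) * rnorm y.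
    apply: cvgMl; apply: cvgMl; apply: cvgB; first exact: cvg_cst.
    by apply: cvg_expr; rewrite ger0_norm.
  have [l hl _] := seq_complete_telescope ss sc.
  exists l; apply/eqP; rewrite -subr_eq0 -rnorm_eq0 eq_le rnorm_ge0 andbT.
  apply/ler_addgt0Pr => e e0; rewrite add0r.
  have e2 : 0 < e / 2 by rewrite divr_gt0.
  move/(cvg0_ltP (fun n => rnorm_ge0 (u n - l))) : hl => /(_ _ e2) [N hN].
  have h0 := hN _ (leqnn N); have h1 := hN _ (leqnSn N).
  have -> : l - T l - y = (l - u N.+1) + T (u N - l).
    rewrite -[u N.+1]/(y + T (u N)) linear_opB// opprD (addrA l) subrKA.
    by rewrite addrAC.
  apply: le_trans (rnormD _ _) _; rewrite (rnormB l).
  have := Tq (u N - l).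
  have : q * rnorm (u N - l) <= rnorm (u N - l).
    by rewrite -[leRHS]mul1r ler_wpM2r ?rnorm_ge0// ltW.
  by move: h0 h1; lra.
pose S y := projT1 (cid (ex y)).
have SP y : S y - T (S y) = y by rewrite /S; case: cid.
exists S; last first.
  by move=> x y; split=> [<-|->//]; apply: inj; rewrite SP.
split.
  move=> a x y; apply: inj; rewrite SP lT opprD addrACA -scalerBr.
  by rewrite !SP.
exists (1 - q)^-1 => y; rewrite mulrC ler_pdivlMr// mulrC.
by have := bd (S y); rewrite SP.
Qed.

(** For [|t| > K] the equation [X x = y + t x] is [x - X x / t = - y / t], and
    [X / t] is a strict contraction. *)
Lemma bounded_op_resolvent (X : V -> V) (K t : R) : linear X ->
  (forall x, rnorm (X x) <= K * rnorm x) -> 0 <= K -> K < `|t| ->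
  resolvent_set (graph X) t%:C.
Proof.
move=> lX hK K0 Kt.
have t0 : t != 0 by rewrite -normr_gt0 (le_lt_trans K0).
have t0' : t%:C != 0 by rewrite -[0]/(0%:C) (inj_eq (@complexI R)).
have nt : 0 < `|t| by rewrite normr_gt0.
have [||||S bS SP] := @neumann (t^-1%:C *: X) (K / `|t|).
- move=> a x y; rewrite -[LHS]/(t^-1%:C *: X _) lX scalerDr.
  rewrite -[(t^-1%:C *: X) x]/(t^-1%:C *: X x) -[(t^-1%:C *: X) y]/(t^-1%:C *: X y).
  by rewrite !scalerA mulrC.
- by rewrite divr_ge0.
- by rewrite ltr_pdivrMr// mul1r.
- move=> x; rewrite -[X in rnorm X]/(t^-1%:C *: X x) rnormZr normfV.
  by rewrite mulrAC mulrC ler_wpM2r// invr_ge0.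
exists (S \o (- t^-1%:C *: id)).
  by apply: bounded_op_comp => //; apply: bounded_opZ; exact: bounded_op_id.
move=> x y; rewrite /graph /= -[(_ *: id) y]/(- t^-1%:C *: y) -SP.
rewrite -[(t^-1%:C *: X) x]/(t^-1%:C *: X x) fmorphV /=; split => [<-|h].
  by rewrite scaleNr scalerDr scalerA mulVf// scale1r opprD addrC subrK.
apply: (scalerI (invr_neq0 t0')); rewrite scalerDr scalerA mulVf// scale1r.
have xE : x = - (t%:C)^-1 *: y + (t%:C)^-1 *: X x by rewrite -h subrK.
by rewrite [in LHS]xE scaleNr addrA subrr add0r.
Qed.

End Neumann.

(** * The negative part of a self-adjoint operator *)

Section PolynomialCalculus.
Variables (R : realType) (V : preHilbertType R) (X : V -> V).
Hypothesis bX : bounded_op X.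
Implicit Types (p q : {poly R}) (x : V).

Lemma poly_op_wide p n x : (size p <= n)%N ->
  poly_op p X x = \sum_(i < n) (p`_i)%:C *: iter i X x.
Proof.
move=> pn; rewrite /poly_op (big_ord_widen n (fun i => (p`_i)%:C *: iter i X x))//.
rewrite big_mkcond /=; apply: eq_bigr => i _; case: ltnP => // h.
by rewrite nth_default// scale0r.
Qed.

Lemma poly_opD p q x : poly_op (p + q) X x = poly_op p X x + poly_op q X x.
Proof.
pose n := maxn (size p) (size q).
rewrite !(@poly_op_wide _ n) ?leq_maxl ?leq_maxr ?size_polyD//.
by rewrite -big_split; apply: eq_bigr => i _; rewrite coefD rmorphD scalerDl.
Qed.

Lemma poly_opZ (c : R) p x : poly_op (c *: p) X x = c%:C *: poly_op p X x.
Proof.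
rewrite (@poly_op_wide _ (size p)) ?size_scale_leq// scaler_sumr.
by apply: eq_bigr => i _; rewrite coefZ rmorphM scalerA.
Qed.

Lemma poly_opB p q x : poly_op (p - q) X x = poly_op p X x - poly_op q X x.
Proof. by rewrite -scaleN1r poly_opD poly_opZ rmorphN1 scaleN1r. Qed.

Lemma poly_opC (c : R) x : poly_op c%:P X x = c%:C *: x.
Proof.
by rewrite (@poly_op_wide _ 1) ?size_polyC_leq1// big_ord1 coefC.
Qed.

Lemma poly_op_mulX p x : poly_op (p * 'X) X x = poly_op p X (X x).
Proof.
rewrite (@poly_op_wide _ (size p).+1); last first.
  by apply: leq_trans (size_polyMleq _ _) _; rewrite size_polyX addnC.
rewrite big_ord_recl coefMX /= scale0r add0r /poly_op.
by apply: eq_bigr => i _; rewrite coefMX /= -iterSr.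
Qed.

Lemma poly_opXmul p x : poly_op ('X * p) X x = X (poly_op p X x).
Proof.
have lX := bX.1.
elim/poly_ind: p x => [|p c ih] x.
  by rewrite mulr0 -[0]/(0%:P : {poly R}) !poly_opC !scale0r linear_op0.
rewrite mulrDr mulrA !poly_opD !poly_op_mulX ih linear_opD//; congr (_ + _).
by rewrite mulrC poly_op_mulX !poly_opC linear_opZ.
Qed.

Lemma poly_opM p q x : poly_op (p * q) X x = poly_op p X (poly_op q X x).
Proof.
elim/poly_ind: p q => [|p c ih] q.
  by rewrite mul0r -[0]/(0%:P : {poly R}) !poly_opC !scale0r.
rewrite mulrDl !poly_opD -mulrA ih poly_opXmul poly_op_mulX; congr (_ + _).
by rewrite mul_polyC poly_opZ poly_opC.
Qed.

Lemma poly_opX x : poly_op 'X X x = X x.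
Proof. by rewrite -['X]mul1r poly_op_mulX -[1]/(1%:P : {poly R}) poly_opC scale1r. Qed.

Lemma poly_op_bounded p : bounded_op (poly_op p X).
Proof.
elim/poly_ind: p => [|p c ih].
  rewrite (_ : poly_op 0 X = 0); first exact: bounded_op0.
  by apply/funext => x; rewrite -[0]/(0%:P : {poly R}) poly_opC scale0r.
rewrite (_ : poly_op _ X = (poly_op p X \o X) + c%:C *: id).
  by apply: bounded_opD; [exact: bounded_op_comp|apply: bounded_opZ; exact: bounded_op_id].
by apply/funext => x; rewrite poly_opD poly_op_mulX poly_opC.
Qed.

(** [p(X)] acts as [p(m)] on approximate eigenvectors for [m], because
    [p - p(m)] is a multiple of ['X - m]. *)
Lemma poly_op_approx_eigen p (m : R) : exists2 L : R, 0 <= L &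
  forall x, rnorm (poly_op p X x - p.[m]%:C *: x) <= L * rnorm (X x - m%:C *: x).
Proof.
have /factor_theorem[q qE] : root (p - p.[m]%:P) m.
  by rewrite /root !hornerE subrr.
have [L L0 hL] := bounded_op_ex (poly_op_bounded q).
exists L => // x; rewrite -(poly_opC p.[m]) -poly_opB qE poly_opM poly_opB poly_opX poly_opC.
exact: hL.
Qed.

End PolynomialCalculus.

Section SqrtIteration.
Variable R : realType.

(** [P_(k+1) = (1 - t^2/K^2 + P_k^2) / 2], which increases to [1 - |t|/K] on
    [[-K, K]]: the polynomials [K (1 - P_k)] approximate [|t|]. *)
Fixpoint sqrt_poly (K : R) (k : nat) : {poly R} :=
  if k is j.+1 then 2^-1 *: (1 - K ^- 2 *: 'X ^+ 2 + sqrt_poly K j ^+ 2) else 0.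

(** The same iteration at [t = 0]. It dominates [sqrt_poly K k] both on
    [[-K, K]] and in operator norm when [|X| <= K], so its convergence to 1
    alone controls the scalar and the operator approximation. *)
Fixpoint sqrt_seq (k : nat) : R :=
  if k is j.+1 then 2^-1 * (1 + sqrt_seq j ^+ 2) else 0.

Lemma sqrt_seq_itv k : 0 <= sqrt_seq k <= 1.
Proof. by elim: k => [|k /andP[h0 h1]] /=; [rewrite lexx ler01|apply/andP; split; nra]. Qed.

Lemma sqrt_seq_step k : sqrt_seq k.+2 - sqrt_seq k.+1 =
  2^-1 * (sqrt_seq k.+1 - sqrt_seq k) * (sqrt_seq k.+1 + sqrt_seq k).
Proof. by rewrite /=; ring. Qed.

Lemma sqrt_seq_cvg : sqrt_seq k @[k --> \oo] --> (1 : R).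
Proof.
have nd : nondecreasing_seq sqrt_seq.
  by apply/nondecreasing_seqP => n /=; have := sqr_ge0 (1 - sqrt_seq n); nra.
have ub : has_ubound (range sqrt_seq).
  by exists 1 => _ [n _ <-]; have /andP[] := sqrt_seq_itv n.
have /cvg_ex[l hl] := nondecreasing_is_cvgn nd ub.
have hl1 : sqrt_seq k.+1 @[k --> \oo] --> 2^-1 * (1 + l ^+ 2).
  by apply: cvgMr; apply: cvgD; [exact: cvg_cst|exact: (cvgM hl hl)].
have hl2 : sqrt_seq k.+1 @[k --> \oo] --> l.
  by have := hl; rewrite -(cvg_shiftS sqrt_seq).
suff -> : 1 = l by [].
have lE : 2^-1 * (1 + l ^+ 2) = l.
  by rewrite -(cvg_lim (@Rhausdorff R) hl1); apply: (cvg_lim (@Rhausdorff R)).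
have /eqP : (1 - l) ^+ 2 = 0 by move: lE; nra.
by rewrite sqrf_eq0 subr_eq0 => /eqP.
Qed.

Lemma sqrt_poly_step (K : R) k : sqrt_poly K k.+2 - sqrt_poly K k.+1 =
  2^-1 *: ((sqrt_poly K k.+1 - sqrt_poly K k) * (sqrt_poly K k.+1 + sqrt_poly K k)).
Proof.
rewrite [sqrt_poly K k.+2]/= [X in _ - X]/= -scalerBr.
by congr (_ *: _); ring.
Qed.

(** With [r = 1 - |t|/K], a fixed point of the iteration, both gaps [r - P_k]
    and [1 - sqrt_seq k] are multiplied at each step by half the sum of the two
    values compared, which is the larger factor for the second one. *)
Lemma sqrt_poly_horner (K t : R) k : 0 < K -> `|t| <= K ->
  0 <= (1 - `|t| / K) - (sqrt_poly K k).[t] <= 1 - sqrt_seq k.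
Proof.
move=> K0 tK.
pose r := 1 - `|t| / K.
have r0 : 0 <= r by rewrite subr_ge0 ler_pdivrMr// mul1r.
have r1 : r <= 1 by rewrite gerBl divr_ge0// ltW.
suff : (0 <= (sqrt_poly K k).[t] <= sqrt_seq k)
    /\ 0 <= r - (sqrt_poly K k).[t] <= 1 - sqrt_seq k by case.
elim: k => [|k [/andP[ih0 ih1] /andP[ih2 ih3]]].
  by rewrite /= horner0 !subr0 lexx r0 r1.
have /andP[s0 s1] := sqrt_seq_itv k.
rewrite /= !hornerE /=.
have -> : 1 - K ^- 2 * t * t = r * (2 - r).
  rewrite -mulrA -expr2 -(real_normK (num_real t)) /r; field; exact: lt0r_neq0.
move: ((sqrt_poly K k).[t]) ih0 ih1 ih2 ih3 => p ih0 ih1 ih2 ih3.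
split; apply/andP; split; nra.
Qed.

End SqrtIteration.

Section FunctionalCalculus.
Variables (R : realType) (V : preHilbertType R) (X : V -> V).
Hypothesis cV : seq_complete V.
Hypothesis sX : selfadjoint X.

Let bX : bounded_op X := sX.1.

Lemma rdot_selfadjoint x y : rdot (X x) y = rdot x (X y).
Proof. by rewrite /rdot sX.2. Qed.

Section SqrtPolyOp.
Variable K : R.
Hypothesis K0 : 0 < K.
Hypothesis hK : forall x, rnorm (X x) <= K * rnorm x.

(** [1 - X^2/K^2] is a contraction since [|X^2 x| <= K |X x|]. *)
Lemma contraction_one_sub_sqr x : rnorm (poly_op (1 - K ^- 2 *: 'X ^+ 2) X x) <= rnorm x.
Proof.
rewrite poly_opB -[1]/(1%:P : {poly R}) poly_opC scale1r poly_opZ poly_opM// !poly_opX//.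
rewrite -(@ler_pXn2r _ 2) ?nnegrE ?rnorm_ge0// -!rdotxx !rdotE.
rewrite ?(rdotC (X (X x)) x) -rdot_selfadjoint !rdotxx.
have h := hK (X x).
have h2 : rnorm (X (X x)) ^+ 2 <= K ^+ 2 * rnorm (X x) ^+ 2.
  by rewrite -exprMn ler_pXn2r ?nnegrE ?rnorm_ge0// (le_trans _ h) ?rnorm_ge0.
have K2 : 0 < K ^- 2 by rewrite invr_gt0 exprn_gt0.
have : K ^- 2 * (K ^- 2 * rnorm (X (X x)) ^+ 2) <= K ^- 2 * rnorm (X x) ^+ 2.
  rewrite ler_pM2l//; apply: le_trans (_ : K ^- 2 * (K ^+ 2 * rnorm (X x) ^+ 2) <= _).
    by rewrite ler_pM2l.
  by rewrite mulKf// expf_neq0// gt_eqF.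
have : 0 <= K ^- 2 * rnorm (X x) ^+ 2 by rewrite mulr_ge0 ?sqr_ge0 ?ltW.
move: (K ^- 2 * _) (K ^- 2 * _) => p q; lra.
Qed.

Lemma sqrt_poly_op_le k x : rnorm (poly_op (sqrt_poly K k) X x) <= sqrt_seq R k * rnorm x.
Proof.
elim: k x => [|k ih] x.
  by rewrite -[sqrt_poly K 0]/(0%:P) poly_opC scale0r rnorm0 mul0r.
rewrite poly_opZ poly_opD rnormZr ger0_norm ?invr_ge0// -mulrA ler_pM2l ?invr_gt0//.
apply: le_trans (rnormD _ _) _; rewrite mulrDl mul1r lerD ?contraction_one_sub_sqr//.
rewrite poly_opM//; apply: le_trans (ih _) _; rewrite expr2 -mulrA ler_wpM2l//.
by have /andP[] := sqrt_seq_itv R k.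
Qed.

(** [P_(k+2) - P_(k+1) = (P_(k+1) - P_k)(P_(k+1) + P_k) / 2] for the operators
    and for the dominating scalars alike. *)
Lemma sqrt_poly_op_step k x :
  rnorm (poly_op (sqrt_poly K k.+1) X x - poly_op (sqrt_poly K k) X x)
    <= (sqrt_seq R k.+1 - sqrt_seq R k) * rnorm x.
Proof.
rewrite -poly_opB; elim: k x => [|k ih] x.
  by have := sqrt_poly_op_le 1 x; rewrite /sqrt_poly !subr0.
rewrite sqrt_poly_step sqrt_seq_step poly_opZ rnormZr ger0_norm ?invr_ge0//.
rewrite -!mulrA ler_pM2l ?invr_gt0// poly_opM//; apply: le_trans (ih _) _.
rewrite ler_wpM2l//; last first.
  by rewrite poly_opD mulrDl; apply: le_trans (rnormD _ _) _; rewrite lerD ?sqrt_poly_op_le.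
have := ih 0; rewrite rnorm0 mulr0.
rewrite subr_ge0; have /andP[? ?] := sqrt_seq_itv R k.
by have := sqr_ge0 (1 - sqrt_seq R k) => /=; nra.
Qed.

End SqrtPolyOp.

Lemma cvg0_le0 (e : nat -> R) (c : R) :
  e k @[k --> \oo] --> (0 : R) -> (forall k, c <= e k) -> c <= 0.
Proof.
move=> e0 ce; apply/ler_addgt0Pr => d d0; rewrite add0r.
move/cvgrPdist_lt : e0 => /(_ _ d0) [N _ /(_ N (leqnn N))] /=.
rewrite sub0r normrN => h; apply: le_trans (ce N) _.
exact/ltW/(le_lt_trans (ler_norm _)).
Qed.

Lemma bounded_op_lim (T : nat -> V -> V) (Y : V -> V) (e : nat -> R) :
  (forall k, bounded_op (T k)) -> (forall k x, rnorm (T k x - Y x) <= e k * rnorm x) ->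
  e k @[k --> \oo] --> (0 : R) -> bounded_op Y.
Proof.
move=> bT TY e0; split.
  move=> a x y; apply/eqP; rewrite -subr_eq0 -rnorm_eq0 eq_le rnorm_ge0 andbT.
  pose c := rnorm (a *: x + y) + (Normc.normc a * rnorm x + rnorm y).
  have c0 : (fun k => e k * c) @ \oo --> (0 : R) by rewrite -[0](mul0r c); exact: cvgMl.
  apply: (cvg0_le0 c0) => k.
  have -> : Y (a *: x + y) - (a *: Y x + Y y)
      = (a *: (T k x - Y x) + (T k y - Y y)) - (T k (a *: x + y) - Y (a *: x + y)).
    rewrite (bT k).1 scalerBr addrACA -opprD.
    by rewrite [in RHS](opprB _ (Y _)) [RHS]addrC subrKA.
  apply: le_trans (rnorm_sub_le _ _) _; rewrite /c mulrDr addrC lerD//.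
  apply: le_trans (rnormD _ _) _; rewrite mulrDr lerD// rnormZ mulrCA.
  by rewrite ler_wpM2l//; case: (a) => p q; exact: sqrtr_ge0.
have [M M0 hM] := bounded_op_ex (bT 0%N).
exists (M + e 0%N) => x; rewrite mulrDl.
have := ler_rnorm_sub (Y x) (T 0%N x); rewrite rnormB lerBlDr => /le_trans; apply.
by rewrite addrC lerD.
Qed.

(** [t^- = (|t| - t) / 2] is approximated by [(K (1 - P_k) - t) / 2], uniformly
    on [[-K, K]], which contains the real spectrum, and in operator norm by
    telescoping. *)
Lemma funcalc_negpart_ex : exists Y, is_funcalc (fun t : R => Num.max 0 (- t)) X Y.
Proof.
have [M M0 hM] := bounded_op_ex bX.
pose K := M + 1; have K0 : 0 < K by rewrite /K; lra.
have hK x : rnorm (X x) <= K * rnorm x.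
  by apply: le_trans (hM x) _; rewrite ler_wpM2r ?rnorm_ge0// /K; lra.
pose p k : {poly R} := 2^-1 *: (K *: (1 - sqrt_poly K k) - 'X).
pose e k := 2^-1 * K * (1 - sqrt_seq R k).
have e0 : e k @[k --> \oo] --> (0 : R).
  rewrite -[0](mulr0 (2^-1 * K)) -(subrr 1); apply: cvgMr.
  by apply: cvgB; [exact: cvg_cst|exact: sqrt_seq_cvg].
have step x k : rnorm (poly_op (p k.+1) X x - poly_op (p k) X x)
    <= 2^-1 * K * sqrt_seq R k.+1 * rnorm x - 2^-1 * K * sqrt_seq R k * rnorm x.
  have -> : poly_op (p k.+1) X x - poly_op (p k) X x = (2^-1 * K)%:C *:
      (poly_op (sqrt_poly K k) X x - poly_op (sqrt_poly K k.+1) X x).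
    by rewrite -!poly_opB -poly_opZ; congr (poly_op _ X x); rewrite /p -!mul_polyC rmorphM /=; ring.
  rewrite rnormZr ger0_norm ?mulr_ge0 ?invr_ge0 ?(ltW K0)// -mulrBl -mulrBr -[leRHS]mulrA.
  by rewrite ler_pM2l ?mulr_gt0 ?invr_gt0// rnormB sqrt_poly_op_step.
have ex x : exists y, forall k, rnorm (poly_op (p k) X x - y) <= e k * rnorm x.
  have sc : 2^-1 * K * sqrt_seq R k * rnorm x @[k --> \oo] --> 2^-1 * K * 1 * rnorm x.
    by apply: cvgMl; apply: cvgMr; exact: sqrt_seq_cvg.
  have [y _ hy] := seq_complete_telescope cV (step x) sc.
  by exists y => k; apply: le_trans (hy k) _; rewrite -mulrBl -mulrBr.
pose Y x := projT1 (cid (ex x)).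
have YP k x : rnorm (poly_op (p k) X x - Y x) <= e k * rnorm x by rewrite /Y; case: cid.
have bY : bounded_op Y by apply: bounded_op_lim YP e0 => k; exact: poly_op_bounded.
exists Y; split => //; exists p.
  move=> P; rewrite uniform_nbhs => -[E [entE EP]].
  move: entE; rewrite -entourage_ballE => -[d /= d0 dE].
  have : \forall k \near \oo, e k < d.
    move/cvgrPdist_lt : e0 => /(_ _ d0); apply: filterS => k.
    by rewrite sub0r normrN; apply: le_lt_trans; exact: ler_norm.
  apply: filterS => k ekd; apply: EP => t /= st; apply: dE.
  have tK : `|t| <= K.
    rewrite leNgt; apply/negP => Kt; apply: st.
    exact: (bounded_op_resolvent cV bX.1 hK (ltW K0) Kt).
  rewrite /ball /=; apply: le_lt_trans ekd.
  have /andP[h0 h1] := sqrt_poly_horner k K0 tK.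
  rewrite /p !hornerE.
  have -> : Num.max 0 (- t) = 2^-1 * (`|t| - t).
    by case: (ler0P t) => ?; rewrite ?maxEle; case: ifP; lra.
  have -> : `|t| = K * (`|t| / K) by rewrite mulrC divfK// gt_eqF.
  rewrite ler_norml /e; move: (`|t| / K) ((sqrt_poly K k).[t]) (sqrt_seq R k) h0 h1.
  move=> r u s h0 h1.
  have : 0 <= K * (1 - r - u) by rewrite mulr_ge0// (ltW K0).
  have : K * (1 - r - u) <= K * (1 - s) by rewrite ler_pM2l.
  by move=> h2 h3; apply/andP; split; lra.
apply: (@squeeze_cvgr _ _ _ _ (fun=> 0) e) => //; last exact: cvg_cst.
apply: nearW => k; apply/andP; split.
  by apply: opnorm_ge0; apply: bounded_opB => //; exact: poly_op_bounded.
apply: opnorm_le => [|x]; last exact: YP.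
have /andP[_ ?] := sqrt_seq_itv R k.
by rewrite !mulr_ge0 ?invr_ge0 ?subr_ge0 ?(ltW K0).
Qed.

Lemma negpart_funcalc : is_funcalc (fun t : R => Num.max 0 (- t)) X (negpart X).
Proof. by apply: getPex; exact: funcalc_negpart_ex. Qed.

Lemma negpart_bounded : bounded_op (negpart X).
Proof. by have [] := negpart_funcalc. Qed.

(** Let [m] be the infimum of the quadratic form on the unit sphere. It is an
    approximate eigenvalue, hence lies in the spectrum, where the polynomials
    [p_k] defining [X^-] converge to [t^-]; and [|p_k(X)| >= |p_k(m)|]. In the
    limit [|X^-| >= - m] when [m < 0]. *)
Lemma negpart_ge x : - opnorm (negpart X) * rnorm x ^+ 2 <= rdot (X x) x.
Proof.
have [bY [p pf pY]] := negpart_funcalc.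
set Y := negpart X in bY pY *; set o := opnorm Y.
have o0 : 0 <= o := opnorm_ge0 bY.
rewrite leNgt; apply/negP => xo.
have x0 : x != 0.
  by apply: contraTneq xo => ->; rewrite rnorm0 expr0n mulr0 rdot0r ltxx.
have nx : 0 < rnorm x by rewrite rnorm_gt0.
have [M M0 hM] := bounded_op_ex bX.
pose A := [set rdot (X x) x | x in [set x | rnorm x = 1]].
have unit (z : V) : z != 0 -> rnorm ((rnorm z)^-1%:C *: z) = 1.
  by move=> z0; rewrite rnormZr ger0_norm ?invr_ge0 ?rnorm_ge0// mulVf// rnorm_eq0.
have Aunit z : z != 0 -> A (rdot (X z) z / rnorm z ^+ 2).
  move=> z0; exists ((rnorm z)^-1%:C *: z); first exact: unit.
  by rewrite (linear_opZ _ _ bX.1) rdotZl rdotZr mulrA mulrC -expr2 exprVn.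
have iA : has_inf A.
  split; first by eexists; exact: Aunit x0.
  exists (- M) => _ [z /= z1 <-].
  have := rdot_le (X z) z; rewrite z1 mulr1 ler_norml => /andP[+ _].
  by apply: le_trans; rewrite lerN2; have := hM z; rewrite z1 mulr1.
pose m := inf A.
have mo : m < - o.
  apply: le_lt_trans (_ : rdot (X x) x / rnorm x ^+ 2 < _).
    by apply: ge_inf; [exact: iA.2|exact: Aunit].
  by rewrite ltr_pdivrMr// exprn_gt0.
have [P PE] : exists P : V -> V, forall z, P z = X z - m%:C *: z by eexists.
have bP : bounded_op P.
  rewrite (_ : P = X - m%:C *: id); last by apply/funext => z; rewrite PE.
  by apply: (bounded_opB bX); apply: bounded_opZ; exact: bounded_op_id.
have P0 z : 0 <= rdot (P z) z.
  have [->|z0] := eqVneq z 0; first by rewrite rdot0r.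
  have nz : 0 < rnorm z ^+ 2 by rewrite exprn_gt0 ?rnorm_gt0.
  rewrite PE !rdotE rdotxx subr_ge0 -ler_pdivlMr//.
  by apply: ge_inf; [exact: iA.2|exact: Aunit].
have Psym y z : rdot (P y) z = rdot y (P z).
  by rewrite !PE !rdotE rdot_selfadjoint.
have [L' L'0 hL'] := bounded_op_ex bP.
pose L := L' + 1; have L0 : 0 < L by rewrite /L; lra.
have hL z : rnorm (P z) <= L * rnorm z.
  by apply: le_trans (hL' z) _; rewrite ler_wpM2r ?rnorm_ge0// /L; lra.
(* positivity of the form of [P] at [z - P z / L] *)
have PL z : rnorm (P z) ^+ 2 <= L * rdot (P z) z.
  have h1 := P0 (z - L^-1%:C *: P z).
  rewrite (linear_opB _ _ bP.1) (linear_opZ _ _ bP.1) !rdotE (Psym (P z) z) !rdotxx in h1.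
  have h2 : rdot (P (P z)) (P z) <= L * rnorm (P z) ^+ 2.
    by apply: le_trans (rdot_ler _ _) _; rewrite expr2 mulrA ler_wpM2r ?rnorm_ge0.
  have h3 : L^-1 * (L^-1 * rdot (P (P z)) (P z)) <= L^-1 * rnorm (P z) ^+ 2.
    by rewrite ler_pM2l ?invr_gt0// ler_pdivrMl.
  rewrite -ler_pdivrMl//; move: h1 h3.
  by move: (L^-1 * _) (L^-1 * (L^-1 * _)) => u v; lra.
have approx e : 0 < e -> exists2 z, rnorm z = 1 & rnorm (P z) < e.
  move=> e0; have d0 : 0 < e ^+ 2 / L by rewrite divr_gt0 ?exprn_gt0.
  have [_ [z /= z1 <-] hz] := inf_adherent d0 iA; exists z => //.
  rewrite -(@ltr_pXn2r _ 2) ?nnegrE ?rnorm_ge0 ?(ltW e0)//.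
  apply: le_lt_trans (PL z) _; rewrite -ltr_pdivlMl// mulrC.
  rewrite PE !rdotE rdotxx z1 expr1n mulr1 -/(inf A) -/m.
  by move: hz; rewrite -/m; move: (e ^+ 2 / L) => d; lra.
have sm : spectrum (graph X) m%:C.
  move=> [S bS SP]; have [N N0 hN] := bounded_op_ex bS.
  have [|z z1 Pz] := approx (N + 1)^-1; first by rewrite invr_gt0; lra.
  have zS : z = S (P z) by apply/SP; rewrite /graph /= PE subrK.
  have := hN (P z); rewrite -zS z1.
  have : N * rnorm (P z) <= N * (N + 1)^-1 by rewrite ler_wpM2l// ltW.
  have : N * (N + 1)^-1 < 1 by rewrite ltr_pdivrMr; lra.
  by lra.
have pm k : `|(p k).[m]| <= opnorm (poly_op (p k) X - Y) + o.
  apply/ler_addgt0Pr => e e0.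
  have [D D0 hD] := poly_op_approx_eigen bX (p k) m.
  have [|z z1 Pz] := approx (e / (D + 1)); first by rewrite divr_gt0//; lra.
  have h1 := hD z; rewrite rnormB in h1.
  have h2 := ler_rnorm_sub ((p k).[m]%:C *: z) (poly_op (p k) X z).
  rewrite rnormZr z1 mulr1 in h2.
  have h3 := @opnormP _ _ _ (poly_op (p k) X - Y) z (bounded_opB (poly_op_bounded bX _) bY).
  have h4 := opnormP z bY; rewrite z1 !mulr1 in h3 h4.
  have h5 : D * rnorm (P z) <= e.
    have h : D * (e / (D + 1)) <= e.
      by rewrite mulrA ler_pdivrMr; [rewrite mulrC ler_pM2l//|]; lra.
    by apply: le_trans h; rewrite ler_wpM2l// ltW.
  have h6 := rnormD ((poly_op (p k) X - Y) z) (Y z).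
  rewrite -[(_ - Y) z]/(poly_op (p k) X z - Y z) subrK in h6.
  rewrite -[(_ - Y) z]/(poly_op (p k) X z - Y z) in h3.
  by move: h1 h2 h3 h4 h5 h6; rewrite -PE -/o; lra.
have pmc : (p k).[m] @[k --> \oo] --> Num.max 0 (- m).
  have : {uniform [set m], (fun k t => (p k).[t]) @ \oo --> (fun t : R => Num.max 0 (- t))}.
    by apply: uniform_subset_cvg pf => _ ->.
  by rewrite uniform_set1.
have g0 : 0 < (- m - o) / 2 by rewrite divr_gt0//; lra.
have : \forall k \near \oo, False.
  have mm : Num.max 0 (- m) = - m by rewrite maxEle ifT//; lra.
  rewrite mm in pmc.
  move/cvgrPdist_lt : pmc => /(_ _ g0); move/cvgrPdist_lt : pY => /(_ _ g0).
  apply: filterS2 => k; rewrite sub0r normrN => h1 h2.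
  have := pm k; have := ler_norm (opnorm (poly_op (p k) X - Y)).
  have := ler_norm (p k).[m]; have := ler_norm (- m - (p k).[m]).
  by move: h1 h2; lra.
by case/filter_ex.
Qed.

End FunctionalCalculus.

(** * Square-summable sequences *)

Section SquareSummable.
Variables (R : realType) (V : preHilbertType R).
Implicit Types (u v : ell2 V).

Lemma rdot_ell2 u v : rdot u v = limn (series (fun n => rdot (u n) (v n))).
Proof. by []. Qed.

Lemma rnorm_ell2 u : rnorm u ^+ 2 = limn (series (fun n => rnorm (u n) ^+ 2)).
Proof.
rewrite -rdotxx rdot_ell2; congr (limn (series _)).
by apply/funext => n; rewrite rdotxx.
Qed.

Lemma partial_le_rnorm u N : \sum_(i < N) rnorm (u i) ^+ 2 <= rnorm u ^+ 2.
Proof.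
rewrite rnorm_ell2.
have nd : nondecreasing_seq (series (fun n => rnorm (u n) ^+ 2)).
  by apply/nondecreasing_seqP => m; rewrite seriesSr lerDl sqr_ge0.
have := nondecreasing_cvgn_le nd (ell2_cvg (u := u)) N.
by rewrite {1}/series /= big_mkord.
Qed.

Lemma coord_le_rnorm u n : rnorm (u n) <= rnorm u.
Proof.
rewrite -(@ler_pXn2r _ 2) ?nnegrE ?rnorm_ge0//.
apply: le_trans (partial_le_rnorm u n.+1).
by rewrite big_ord_recr lerDr sumr_ge0// => i _; rewrite sqr_ge0.
Qed.

Lemma square_summable_bound (w : nat -> V) (B : R) :
  (forall N, \sum_(i < N) rnorm (w i) ^+ 2 <= B) -> w \in square_summable V.
Proof.
move=> wB; apply/asboolP; apply: nondecreasing_is_cvgn.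
  by apply/nondecreasing_seqP => m; rewrite seriesSr lerDl sqr_ge0.
by exists B => _ [N _ <-]; rewrite /series /= big_mkord.
Qed.

Lemma rnorm_ell2_le u (B : R) : 0 <= B ->
  (forall N, \sum_(i < N) rnorm (u i) ^+ 2 <= B ^+ 2) -> rnorm u <= B.
Proof.
move=> B0 uB; rewrite -(@ler_pXn2r _ 2) ?nnegrE ?rnorm_ge0// rnorm_ell2.
apply: limr_le; first exact: ell2_cvg.
by apply: nearW => N; rewrite /series /= big_mkord.
Qed.

Lemma rdot_ell2_fin u v N : (forall n, (N <= n)%N -> u n = 0) ->
  rdot u v = \sum_(i < N) rdot (u i) (v i).
Proof.
move=> u0; rewrite rdot_ell2; apply: (cvg_lim (@Rhausdorff R)).
apply: cvg_near_cst.
exists N => // n /= Nn; rewrite /series /= big_mkord -(subnKC Nn) big_split_ord /=.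
rewrite [X in _ + X]big1 ?addr0// => i _.
by rewrite u0 ?leq_addr// rdot0l.
Qed.

Lemma rnorm_cvg_sub (x l : V) (w : nat -> V) :
  rnorm (w n - l) @[n --> \oo] --> (0 : R) ->
  rnorm (x - w n) @[n --> \oo] --> rnorm (x - l).
Proof.
move/cvgrPdist_le => wl; apply/cvgrPdist_le => e /wl; apply: filterS => n.
rewrite sub0r normrN ger0_norm ?rnorm_ge0// => /(le_trans _); apply.
have h1 := rnorm_triangle (w n) x l; have h2 := rnorm_triangle l x (w n).
rewrite (rnormB l) in h2; rewrite ler_norml.
by apply/andP; split; move: h1 h2; lra.
Qed.

(** Coordinatewise limits of a Cauchy sequence; the Cauchy estimate passes to
    the limit on each finite partial sum. *)
Lemma ell2_seq_complete : seq_complete V -> seq_complete (ell2 V).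
Proof.
move=> cV u cu.
have exl n : exists l, rnorm (u k n - l) @[k --> \oo] --> (0 : R).
  apply: cV => e /cu [N hN]; exists N => j k Nj Nk.
  exact: le_lt_trans (coord_le_rnorm (u j - u k) n) (hN _ _ Nj Nk).
pose l n := projT1 (cid (exl n)).
have lP n : rnorm (u k n - l n) @[k --> \oo] --> (0 : R) by rewrite /l; case: cid.
have tail e : 0 < e -> exists N, forall k, (N <= k)%N ->
    forall M, \sum_(i < M) rnorm (u k i - l i) ^+ 2 <= e ^+ 2.
  move=> e0; have [N hN] := cu _ e0; exists N => k Nk M.
  have lim : \sum_(i < M) rnorm (u k i - u j i) ^+ 2 @[j --> \oo] -->
      \sum_(i < M) rnorm (u k i - l i) ^+ 2.
    apply: cvg_big => [|i _]; first exact: add_continuous.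
     apply: cvgM; exact: rnorm_cvg_sub.
  rewrite -(cvg_lim (@Rhausdorff R) lim); apply: limr_le.
    by apply/cvg_ex; eexists; exact: lim.
  exists N => // j /= Nj; apply: le_trans (partial_le_rnorm (u k - u j) M) _.
  by rewrite ler_pXn2r ?nnegrE ?rnorm_ge0 ?(ltW e0)// ltW// hN.
have [N1 hN1] := tail 1 ltr01.
have dl : (fun i => u N1 i - l i) \in square_summable V.
  by apply: square_summable_bound (1 ^+ 2) _ => M; exact: hN1.
have ll : l \in square_summable V.
  rewrite (_ : l = val (u N1 - Ell2 dl)); first exact: valP.
  by apply/funext => n /=; rewrite opprB addrC subrK.
exists (Ell2 ll); apply/cvg0_ltP => [k|e e0]; first exact: rnorm_ge0.
have e2 : 0 < e / 2 by rewrite divr_gt0.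
have [N hN] := tail _ e2; exists N => k /hN h.
have := @rnorm_ell2_le (u k - Ell2 ll) _ (ltW e2) h.
by move=> /le_lt_trans; apply; lra.
Qed.

End SquareSummable.

(** If [x = S y] solves [(G - z) x = y], then [(G - w) x = y] reads
    [x - (w - z) S x = S y], solvable by the Neumann series for [w] near [z]. *)
Lemma resolvent_set_open (R : realType) (V : preHilbertType R)
    (cV : seq_complete V) (G : set (V * V)) (z : R[i]) :
  resolvent_set G z -> exists2 d : R, 0 < d &
    forall w, Normc.normc (w - z) < d -> resolvent_set G w.
Proof.
move=> [S bS SP]; have [M M0 hM] := bounded_op_ex bS.
have M1 : 0 < M + 1 by lra.
exists (M + 1)^-1; first by rewrite invr_gt0.
move=> w wz; pose e := w - z.
have e0 : 0 <= Normc.normc e by case: (e) => p q; exact: sqrtr_ge0.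
have [||||W bW WP] := neumann cV (T := e *: S) (q := Normc.normc e * M).
- exact: (bounded_opZ e bS).1.
- by rewrite mulr_ge0.
- apply: le_lt_trans (_ : (M + 1)^-1 * M < 1).
    by rewrite ler_wpM2r// ltW.
  by rewrite ltr_pdivrMl//; lra.
- by move=> x; rewrite -[X in rnorm X]/(e *: S x) rnormZ -mulrA ler_wpM2l.
exists (W \o S); first exact: bounded_op_comp.
move=> x y; have -> : y + w *: x = (y + e *: x) + z *: x.
  by rewrite -addrA -scalerDl subrK.
rewrite SP /= -WP (linear_opD _ _ bS.1) (linear_opZ _ _ bS.1).
rewrite -[(e *: S) x]/(e *: S x).
by split=> [xE|<-]; [rewrite {1}xE addrK|rewrite subrK].
Qed.

(** * The adjoint of the block Jacobi matrix *)

Section JacobiAdjoint.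
Variables (R : realType) (H : hilbertType R) (a b : nat -> H -> H).
Hypothesis a_bounded : forall n, bounded_op (a n).
Hypothesis b_selfadj : forall n, selfadjoint (b n).
Let cH : seq_complete H := hilbert_seq_complete (H := H).

Lemma linear_adj n : linear (adj (a n)).
Proof. exact: (adj_bounded cH (a_bounded n)).1. Qed.

Let lower (u : nat -> H) n := if n is m.+1 then adj (a m) (u m) else 0.

Let formal_jacobiE u n :
  formal_jacobi a b u n = lower u n + b n (u n) + a n (u n.+1).
Proof. by case: n => [|n] //=; rewrite add0r. Qed.

(** Summation by parts: the formal matrix is symmetric against finitely
    supported sequences. *)
Lemma formal_jacobi_green (e x : nat -> H) N :
  (forall n, (N <= n)%N -> e n = 0) ->
  \sum_(k < N.+1) rdot (formal_jacobi a b e k) (x k) =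
  \sum_(k < N) rdot (e k) (formal_jacobi a b x k).
Proof.
move=> e0.
rewrite (eq_bigr (fun k : 'I_N.+1 => rdot (lower e k) (x k) +
    rdot (e k) (b k (x k)) + rdot (e k.+1) (adj (a k) (x k)))); last first.
  move=> k _; rewrite formal_jacobiE !rdotDl (rdot_adj cH _ _ (a_bounded k)).
  by rewrite (rdot_selfadjoint (b_selfadj k)).
rewrite [RHS](eq_bigr (fun k : 'I_N => rdot (e k) (a k (x k.+1)) +
    rdot (e k) (b k (x k)) + rdot (e k) (lower x k))); last first.
  by move=> k _; rewrite formal_jacobiE !rdotDr; ring.
rewrite !big_split /=; congr (_ + _ + _).
- rewrite big_ord_recl /= rdot0l add0r; apply: eq_bigr => k _.
  by rewrite rdotC -(rdot_adj cH _ _ (a_bounded k)) rdotC.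
- by rewrite big_ord_recr /= e0// rdot0l addr0.
- rewrite big_ord_recr /= (e0 N.+1)// rdot0l addr0.
  have : \sum_(k < N.+1) rdot (e k) (lower x k) = \sum_(k < N.+1) rdot (e k) (lower x k) by [].
  rewrite {1}big_ord_recl {1}big_ord_recr /= rdot0r add0r (e0 N)// rdot0l addr0.
  by move=> <-; apply: eq_bigr.
Qed.

Lemma fin_square_summable (w : nat -> H) N :
  (forall n, (N <= n)%N -> w n = 0) -> w \in square_summable H.
Proof.
move=> w0; apply: (@square_summable_bound _ _ _ (\sum_(i < N) rnorm (w i) ^+ 2)) => M.
have [MN|NM] := leqP M N.
  rewrite -(subnKC MN) big_split_ord /= lerDl sumr_ge0// => i _; exact: sqr_ge0.
rewrite -(subnKC (ltnW NM)) big_split_ord /= [X in _ + X]big1 ?addr0// => i _.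
by rewrite w0 ?leq_addr// rnorm0 expr0n.
Qed.

(** Test the definition of the adjoint on the sequences supported at a single
    index: they lie in the domain before closure. *)
Lemma adj_graph_jacobi (x y : ell2 H) : adj_graph (jacobi a b) (x, y) ->
  forall n, y n = formal_jacobi a b x n.
Proof.
move=> xy n; apply: rdot_inj => h.
pose e k := if k == n then h else 0.
have e0 k : (n.+1 <= k)%N -> e k = 0 by rewrite /e; case: eqP => // ->; rewrite ltnn.
have f0 k : (n.+2 <= k)%N -> formal_jacobi a b e k = 0.
  case: k => // k; rewrite ltnS => nk; rewrite formal_jacobiE /= !e0 ?(leqW nk)//; last exact: leqW (leqW nk).
  by rewrite (linear_op0 (linear_adj _)) (linear_op0 (b_selfadj _).1.1) (linear_op0 (a_bounded _).1) !addr0.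
pose q := (Ell2 (fin_square_summable e0), Ell2 (fin_square_summable f0)).
have : rdot q.2 x = rdot q.1 y.
  congr complex.Re; apply: (xy q); apply: subset_closure.
  by split => //; exists n.+1.
rewrite (@rdot_ell2_fin _ _ q.2 x _ f0) (@rdot_ell2_fin _ _ q.1 y _ e0) /=.
rewrite formal_jacobi_green//.
have pick (w : nat -> H) : \sum_(i < n.+1) rdot (e i) (w i) = rdot h (w n).
  rewrite big_ord_recr /= {2}/e eqxx big1 ?add0r// => i _.
  by rewrite /e ltn_eqF// rdot0l.
by rewrite !pick => ->.
Qed.

End JacobiAdjoint.

(** * A growth comparison for real sequences *)

Section GrowthComparison.
Variable R : realType.
Implicit Types (f : nat -> R).

Lemma nneseries_partial_bound f m : (forall n, 0 <= f n) ->
  (\sum_(m <= n <oo) (f n)%:E < +oo)%E ->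
  exists B, forall N, \sum_(m <= n < N) f n <= B.
Proof.
move=> f0 foo.
have ge N : ((\sum_(m <= n < N) f n)%:E <= \sum_(m <= n <oo) (f n)%:E)%E.
  rewrite -sumEFin; apply: (@nneseries_lim_ge _ (fun n => (f n)%:E) xpredT) => n _ _.
  by rewrite lee_fin.
have fin : (\sum_(m <= n <oo) (f n)%:E)%E \is a fin_num.
  by rewrite ge0_fin_numE// (le_trans _ (ge 0%N))// lee_fin sumr_ge0.
exists (fine (\sum_(m <= n <oo) (f n)%:E)%E) => N.
by rewrite -lee_fin fineK.
Qed.

Lemma nneseries_partial_unbounded f m : (forall n, 0 <= f n) ->
  (\sum_(m <= n <oo) (f n)%:E = +oo)%E ->
  forall B, exists N, B < \sum_(m <= n < N) f n.
Proof.
move=> f0 foo B; apply: contrapT => /forallNP h.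
have : (\sum_(m <= n <oo) (f n)%:E <= B%:E)%E.
  apply: lime_le; first by apply: is_cvg_nneseries => n _ _; rewrite lee_fin.
  apply: nearW => N; rewrite sumEFin lee_fin leNgt.
  by apply/negP => /h.
by rewrite foo leye_eq.
Qed.

Lemma partial_bound_tail f (B e : R) : (forall n, 0 <= f n) ->
  (forall N, \sum_(1 <= n < N) f n <= B) -> 0 < e ->
  exists N0, forall N M, (N0 <= N)%N -> \sum_(N <= n < M) f n <= e.
Proof.
move=> f0 fB e0.
pose t N := \sum_(1 <= n < N.+1) f n.
have tnd : nondecreasing_seq t.
  by apply/nondecreasing_seqP => n; rewrite /t [leRHS]big_nat_recr//= lerDl.
have /cvg_ex[l tl] : cvgn t.
  by apply: nondecreasing_is_cvgn => //; exists B => _ [N _ <-]; exact: fB.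
have tle N : t N <= l.
  by rewrite -(cvg_lim (@Rhausdorff R) tl); apply: nondecreasing_cvgn_le => //; apply/cvg_ex; exists l.
move/cvgrPdist_lt : tl => /(_ _ e0) [N0 _ hN0]; exists N0.+1 => -[//|N] M NN.
have [NM|MN] := ltnP N M; last by rewrite big_geq ?(ltW e0)// leqW.
case: M NM => // M NM.
have := tle M; rewrite /t (@big_cat_nat _ _ _ N.+1) //= -/(t N).
have := hN0 N NN; rewrite /= ger0_norm ?subr_ge0 ?tle//.
by move: (\sum_(N.+1 <= n < M.+1) f n) => r; lra.
Qed.

(** If [S n] is comparable with [w n (x n + x n.+1)] and decreases only by a
    summable relative amount, then either it vanishes somewhere or it stays
    away from zero; in the latter case [x n + x n.+1] dominates [1 / w n],
    whose sum diverges. *)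
Lemma summable_vanish (x S w eta : nat -> R) (c K X B : R) (N0 : nat) :
  (forall n, 0 <= x n) -> (forall n, 0 < w n) -> (forall n, 0 <= eta n) ->
  0 < c -> 0 < K ->
  (forall N, \sum_(0 <= n < N) x n <= X) ->
  (forall N, \sum_(1 <= n < N) eta n / w n <= B) ->
  (forall D, exists N, D < \sum_(0 <= n < N) (w n)^-1) ->
  (forall n, (N0 <= n)%N -> c * (w n * (x n + x n.+1)) <= S n) ->
  (forall n, (N0 <= n)%N -> S n <= K * (w n * (x n + x n.+1))) ->
  (forall n, (N0 <= n)%N -> S n - eta n * (x n + x n.+1) <= S n.+1) ->
  exists n, x n = 0 /\ x n.+1 = 0.
Proof.
move=> x0 w0 eta0 c0 K0 xX etaB winf Sge Sle Sstep.
have ew0 n : 0 <= eta n / w n by rewrite divr_ge0// ltW.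
have c2 : 0 < c / 2 by rewrite divr_gt0.
have [N1 tail] := partial_bound_tail ew0 etaB c2.
pose N := maxn N0 N1.
have NN0 n : (N <= n)%N -> (N0 <= n)%N by apply: leq_trans; exact: leq_maxl.
have xx0 n : 0 <= x n + x n.+1 by rewrite addr_ge0.
have S0 n : (N <= n)%N -> 0 <= S n.
  by move=> /NN0 h; apply: le_trans (Sge _ h); rewrite !mulr_ge0// ltW.
have [SN|SN] := leP (S N) 0.
  exists N; have := le_trans (Sge _ (NN0 _ (leqnn N))) SN.
  rewrite pmulr_rle0// pmulr_rle0// => h.
  by have := x0 N; have := x0 N.+1; move: h => h h1 h2; split; lra.
pose e n := eta n / w n / c.
have e0 n : 0 <= e n by rewrite divr_ge0// ltW.
have stepe n : (N <= n)%N -> S n * (1 - e n) <= S n.+1.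
  move=> Nn; apply: le_trans (Sstep _ (NN0 _ Nn)).
  rewrite mulrBr mulr1 lerD2l lerN2.
  have -> : eta n * (x n + x n.+1) = c * (w n * (x n + x n.+1)) * e n.
    by rewrite /e; field; rewrite !gt_eqF.
  by rewrite ler_wpM2r// Sge// NN0.
have sum_le n : \sum_(N <= k < n) e k <= 2^-1.
  rewrite -mulr_suml ler_pdivrMr// mulrC.
  exact: tail (leq_maxr _ _).
(* [(1 - p) (1 - q) >= 1 - p - q] bounds the product of the decrease factors *)
have lower n : (N <= n)%N -> S N * (1 - \sum_(N <= k < n) e k) <= S n.
  move=> /subnKC <-; elim: (n - N)%N => [|k ih].
    by rewrite addn0 big_geq// subr0 mulr1.
  rewrite addnS; apply: le_trans (stepe _ (leq_addr _ _)).
  have := sum_le (N + k).+1; rewrite !big_nat_recr ?leq_addr//= => h.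
  move: ih (e0 (N + k)%N) SN => ih ek sn.
  have sg : 0 <= \sum_(N <= i < N + k) e i by rewrite sumr_ge0.
  move: (\sum_(N <= i < N + k) e i) (e (N + k)%N) (S (N + k)%N) ih ek h sg => p q r ih ek h sg.
  apply: le_trans (_ : S N * (1 - p) * (1 - q) <= _).
    by rewrite -mulrA ler_pM2l//; nra.
  by rewrite ler_wpM2r//; lra.
have half n : (N <= n)%N -> S N / 2 <= S n.
  move=> Nn; apply: le_trans (lower _ Nn); rewrite ler_pM2l//.
  by have := sum_le n; lra.
have wle n : (N <= n)%N -> (w n)^-1 <= 2 * K / S N * (x n + x n.+1).
  move=> Nn; have := le_trans (half _ Nn) (Sle _ (NN0 _ Nn)).
  rewrite ler_pdivrMr// => h.
  have -> : 2 * K / S N * (x n + x n.+1) = K * (w n * (x n + x n.+1)) * 2 / S N / w n.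
    by field; rewrite !gt_eqF.
  by rewrite ler_pdivlMr// mulVf ?gt_eqF// ler_pdivlMr// mul1r.
have KS : 0 <= 2 * K / S N by rewrite divr_ge0 ?mulr_ge0// ltW.
have wi0 n : 0 <= (w n)^-1 by rewrite invr_ge0 ltW.
have [M] := winf (\sum_(0 <= n < N) (w n)^-1 + 2 * K / S N * (X + X)).
rewrite ltNge => /negP[].
apply: le_trans (_ : \sum_(0 <= n < N + M) (w n)^-1 <= _).
  by rewrite addnC (@big_cat_nat _ _ _ M 0%N (M + N)%N) ?leq_addr//= lerDl sumr_ge0.
rewrite (@big_cat_nat _ _ _ N 0%N (N + M)%N) ?leq_addr//= lerD2l.
apply: le_trans (_ : \sum_(N <= n < N + M) 2 * K / S N * (x n + x n.+1) <= _).
  by rewrite big_nat_cond [leRHS]big_nat_cond ler_sum// => n /andP[/andP[/wle]].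
rewrite -mulr_sumr ler_wpM2l// big_split lerD//.
  apply: le_trans (xX (N + M)%N).
  by rewrite [leRHS](@big_cat_nat _ _ _ N) ?leq_addr//= lerDr sumr_ge0.
rewrite -(big_add1 _ _ N (N + M).+1 xpredT x).
apply: le_trans (xX (N + M).+1).
rewrite [leRHS](@big_cat_nat _ _ _ N.+1) ?ltnS ?leq_addr//= lerDr sumr_ge0//.
Qed.

End GrowthComparison.

(** * Generalized eigenvectors *)

Lemma block_op_bounded (R : realType) (U V : preHilbertType R)
    (T11 : U -> U) (T12 : V -> U) (T21 : U -> V) (T22 : V -> V) :
  bounded_op T11 -> bounded_op T12 -> bounded_op T21 -> bounded_op T22 ->
  bounded_op (block_op T11 T12 T21 T22).
Proof.
move=> b11 b12 b21 b22.
have [M11 p11 h11] := bounded_op_ex b11; have [M12 p12 h12] := bounded_op_ex b12.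
have [M21 p21 h21] := bounded_op_ex b21; have [M22 p22 h22] := bounded_op_ex b22.
split.
  move=> a x y; rewrite /block_op /=.
  rewrite -[RHS]/(a *: (T11 x.1 + T12 x.2) + (T11 y.1 + T12 y.2),
                  a *: (T21 x.1 + T22 x.2) + (T21 y.1 + T22 y.2)).
  by rewrite b11.1 b12.1 b21.1 b22.1 !scalerDr; congr (_, _); rewrite addrACA.
exists (M11 + M12 + (M21 + M22)) => x; apply: le_trans (rnorm_hsum_le _) _ => /=.
have le1 := rnorm_fst_le x; have le2 := rnorm_snd_le x.
rewrite !mulrDl !lerD//; apply: le_trans (rnormD _ _) _; rewrite lerD//;
  by [apply: le_trans (h11 _) _; rewrite ler_wpM2l|
      apply: le_trans (h12 _) _; rewrite ler_wpM2l|
      apply: le_trans (h21 _) _; rewrite ler_wpM2l|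
      apply: le_trans (h22 _) _; rewrite ler_wpM2l].
Qed.

Lemma invop_bounded (R : realType) (U V : preHilbertType R) (T : U -> V) :
  boundedly_invertible T -> bounded_op (invop T).
Proof.
move=> [S bS [TS ST]]; rewrite (_ : invop T = S)//; apply/funext => y.
have : [set x | T x = y] (invop T y) by apply: getPex; exists (S y) => /=.
by move=> /= h; rewrite -[LHS]TS h.
Qed.

Lemma invopK (R : realType) (U V : preHilbertType R) (T : U -> V) :
  boundedly_invertible T -> cancel (invop T) T.
Proof.
move=> [S bS [TS ST]] y.
by have : [set x | T x = y] (invop T y) by apply: getPex; exists (S y) => /=.
Qed.

Section GeneralizedEigenvectors.
Variables (R : realType) (H : hilbertType R) (a b alpha : nat -> H -> H).
Hypothesis a_bounded : forall n, bounded_op (a n).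
Hypothesis a_inv : forall n, boundedly_invertible (a n).
Hypothesis b_selfadj : forall n, selfadjoint (b n).
Hypothesis alpha_bounded : forall n, bounded_op (alpha n).
Let cH : seq_complete H := hilbert_seq_complete (H := H).
Local Notation beta := (conj_alpha a alpha).
Local Notation w := (weight a alpha).

Let adja_bounded n : bounded_op (adj (a n)) := adj_bounded cH (a_bounded n).

Lemma conj_alpha_bounded n : bounded_op (beta n).
Proof.
by do !apply: bounded_op_comp => //; exact: invop_bounded.
Qed.

Lemma lambda_block_bounded (l : R) n : bounded_op (lambda_block a b alpha l n).
Proof.
apply: block_op_bounded.
- exact: bounded_op_comp.
- apply: bounded_opN; apply: bounded_op_comp; last exact: conj_alpha_bounded.
  apply: bounded_opB; last exact: (b_selfadj n).1.
  by apply: bounded_opZ; exact: bounded_op_id.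
- exact: bounded_op0.
- by apply: bounded_op_comp => //; exact: conj_alpha_bounded.
Qed.

Lemma weight_ge0 n : 0 <= w n.
Proof. by apply: opnorm_ge0; exact: bounded_op_comp. Qed.

(** The quadratic form of the operators whose limit defines [C], at two
    consecutive terms of [u]. *)
Definition block_form (l : R) (u : nat -> H) n : R :=
  rdot (lambda_block a b alpha l n ((u n, u n.+1) : hsum H H))
       ((u n, u n.+1) : hsum H H).

Lemma block_formE l u n : block_form l u n =
  rdot (alpha n (adj (a n) (u n))) (u n)
  - (l * rdot (beta n (u n.+1)) (u n) - rdot (b n (beta n (u n.+1))) (u n))
  + rdot (adj (a n) (beta n (u n.+1))) (u n.+1).
Proof.
rewrite /block_form rdot_hsum /= add0r rdotDl.
rewrite -[(- _) (u n.+1)]/(- (l%:C *: beta n (u n.+1) - b n (beta n (u n.+1)))).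
by rewrite !rdotE; ring.
Qed.

Lemma rdot_adja n x y : rdot (adj (a n) x) y = rdot x (a n y).
Proof. by rewrite rdotC -(rdot_adj cH _ _ (a_bounded n)) rdotC. Qed.

(** Eliminating [a_n u_(n+1)] by the recurrence turns the form into a
    Turan-type determinant of three consecutive terms. *)
Lemma block_form_turan l u n :
  formal_jacobi a b u n.+1 = l%:C *: u n.+1 ->
  block_form l u n.+1 = rdot (alpha n.+1 (adj (a n.+1) (u n.+1))) (u n.+1)
    - rdot (alpha n (a n.+1 (u n.+2))) (u n).
Proof.
move=> /= rec; rewrite block_formE rdot_adja.
have E : a n.+1 (u n.+2) = l%:C *: u n.+1 - b n.+1 (u n.+1) - adj (a n) (u n).
  by rewrite -rec [adj _ _ + _ + _]addrC addrA !addrK.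
rewrite [X in _ + rdot _ X = _]E !rdotE -(rdot_selfadjoint (b_selfadj n.+1)).
rewrite [rdot _ (adj (a n) (u n))]rdotC rdot_adja [rdot (u n) _]rdotC.
by rewrite /conj_alpha /= (invopK (a_inv n)); ring.
Qed.

(** In the determinant of [block_form_turan] at [n + 1], expanding
    [a_(n+1) u_(n+2)] by the recurrence cancels the term
    [<alpha_n a_n^* u_n, u_n>]. What remains are the quadratic and sesquilinear
    forms of the three operators whose sizes are assumed summable. *)
Lemma block_form_step l u n :
  formal_jacobi a b u n.+1 = l%:C *: u n.+1 ->
  block_form l u n.+1 - block_form l u n =
    rdot (((alpha n.+1 \o adj (a n.+1)) - (adj (a n) \o beta n)) (u n.+1)) (u n.+1)
    + l * rdot ((beta n - alpha n) (u n.+1)) (u n)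
    + rdot (((alpha n \o b n.+1) - (b n \o beta n)) (u n.+1)) (u n).
Proof.
move=> rec; rewrite (block_form_turan rec) block_formE.
have -> : a n.+1 (u n.+2) = l%:C *: u n.+1 - b n.+1 (u n.+1) - adj (a n) (u n).
  by rewrite -rec /= [adj _ _ + _ + _]addrC addrA !addrK.
have lal := (alpha_bounded n).1.
rewrite !(linear_opB _ _ lal) (linear_opZ _ _ lal).
have opB (S T : H -> H) x : (S - T) x = S x - T x by [].
rewrite !opB /=.
by rewrite !rdotE; ring.
Qed.

(** Bounds the decrease of the block form in one step, per unit of
    [|u_n|^2 + |u_(n+1)|^2]; divided by the weight, its terms are those of the
    three convergent series. *)
Definition step_defect (l : R) n : R :=
  opnorm (negpart (Reop ((alpha n.+1 \o adj (a n.+1)) - (adj (a n) \o beta n))))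
  + `|l| * opnorm (beta n - alpha n)
  + opnorm ((alpha n \o b n.+1) - (b n \o beta n)).

Let bnd1 n : bounded_op ((alpha n.+1 \o adj (a n.+1)) - (adj (a n) \o beta n)).
Proof.
by apply: bounded_opB; apply: bounded_op_comp => //; exact: conj_alpha_bounded.
Qed.

Let bnd2 n : bounded_op (beta n - alpha n).
Proof. by apply: bounded_opB => //; exact: conj_alpha_bounded. Qed.

Let bnd3 n : bounded_op ((alpha n \o b n.+1) - (b n \o beta n)).
Proof.
apply: bounded_opB; apply: bounded_op_comp => //.
- exact: (b_selfadj _).1.
- exact: (b_selfadj _).1.
- exact: conj_alpha_bounded.
Qed.

Lemma block_form_decrease l u n :
  formal_jacobi a b u n.+1 = l%:C *: u n.+1 ->
  block_form l u n - step_defect l n * (rnorm (u n) ^+ 2 + rnorm (u n.+1) ^+ 2)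
    <= block_form l u n.+1.
Proof.
move=> rec; rewrite lerBlDr -lerBlDl -opprB lerNl (block_form_step rec).
set x := rnorm (u n); set y := rnorm (u n.+1).
have x0 : 0 <= x by exact: rnorm_ge0.
have y0 : 0 <= y by exact: rnorm_ge0.
have sX := Reop_selfadjoint cH (bnd1 n).
have := negpart_ge cH sX (u n.+1); rewrite (rdot_Reop cH _ (bnd1 n)) -/y.
have := rdot_opnorm (u n.+1) (u n) (bnd2 n).
have := rdot_opnorm (u n.+1) (u n) (bnd3 n); rewrite -/x -/y.
have o1 := opnorm_ge0 (negpart_bounded cH sX).
have o2 := opnorm_ge0 (bnd2 n); have o3 := opnorm_ge0 (bnd3 n).
rewrite /step_defect; move: o1 o2 o3.
move: (opnorm _) (opnorm (beta n - alpha n)) (opnorm (negpart _)) => o3 o2 o1 p1 p2 p3.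
move: (rdot _ _) (rdot ((beta n - alpha n) _) _) (rdot _ (u n.+1)) => r3 r2 r1 h3 h2 h1.
have xy : y * x <= x ^+ 2 + y ^+ 2 by nra.
have k3 : `|r3| <= o3 * (x ^+ 2 + y ^+ 2).
  by apply: le_trans h3 _; rewrite -mulrA ler_wpM2l.
have k2 : `|l * r2| <= `|l| * o2 * (x ^+ 2 + y ^+ 2).
  rewrite normrM -mulrA ler_wpM2l//.
  by apply: le_trans h2 _; rewrite -mulrA ler_wpM2l.
have k1 : - (o1 * (x ^+ 2 + y ^+ 2)) <= r1.
  by apply: le_trans h1; rewrite mulNr lerN2 ler_wpM2l// lerDr sqr_ge0.
have := ler_norm (- r3); have := ler_norm (- (l * r2)); rewrite !normrN.
move: k1 k2 k3; rewrite !mulrDl; lra.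
Qed.

(** The normalized blocks converge to [C], which lies between [c] and its norm;
    half of [c] absorbs the error for large [n]. *)
Lemma Lambda_block_form l u : (forall n, 0 < w n) -> Lambda a b alpha l ->
  exists c K N, [/\ 0 < c, 0 < K & forall n, (N <= n)%N ->
    c * (w n * (rnorm (u n) ^+ 2 + rnorm (u n.+1) ^+ 2)) <= block_form l u n
      <= K * (w n * (rnorm (u n) ^+ 2 + rnorm (u n.+1) ^+ 2))].
Proof.
move=> w0 [C limC [[bC _] [c c0 Cc]]].
have cHH : seq_complete (hsum H H) := hsum_seq_complete cH cH.
have c2 : 0 < c / 2 by rewrite divr_gt0.
have oC := opnorm_ge0 bC.
move/cvgrPdist_lt : limC => /(_ _ c2) [N _ hN].
exists (c / 2), (c / 2 + opnorm C), N; split => //; first by rewrite ltr_wpDr.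
move=> n /hN /=; rewrite sub0r normrN => /(le_lt_trans (ler_norm _)) Dc.
pose z : hsum H H := (u n, u n.+1).
have zE : rnorm (u n) ^+ 2 + rnorm (u n.+1) ^+ 2 = rnorm z ^+ 2 by rewrite rnorm_hsum.
have bL := lambda_block_bounded l n.
have bR := (Reop_selfadjoint cHH bL).1.
have bD := bounded_opB (bounded_opZ (w n)^-1%:C bR) bC.
have := rdot_opnorm z z bD.
rewrite -[X in rdot X z]/((w n)^-1%:C *: Reop (lambda_block a b alpha l n) z - C z).
rewrite rdotBl rdotZl (rdot_Reop cHH _ bL) -mulrA -expr2 -/(block_form l u n).
have h1 : c * rnorm z ^+ 2 <= rdot (C z) z.
  have := Cc z; rewrite lecE => /andP[_ /=].
  by rewrite -/(rdot _ _) rdotBl rdotZl rdotxx subr_ge0.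
have h2 : rdot (C z) z <= opnorm C * rnorm z ^+ 2.
  by apply: le_trans (ler_norm _) _; rewrite expr2 mulrA rdot_opnorm.
have z2 : 0 <= rnorm z ^+ 2 by rewrite sqr_ge0.
have h3 := ler_wpM2r z2 (ltW Dc).
move=> /le_trans/(_ h3) {h3}; rewrite ler_norml => /andP[h4 h5].
rewrite zE mulrCA (mulrCA _ (w n)).
rewrite -ler_pdivlMl// -[X in _ && X]ler_pdivrMl//.
apply/andP; split; rewrite ?mulrDl; lra.
Qed.

Let adja_inj n x : adj (a n) x = 0 -> x = 0.
Proof.
move=> ax; apply: rdot_inj => y; rewrite rdot0r rdotC.
by rewrite -(invopK (a_inv n) y) -rdot_adja ax rdot0l.
Qed.

Let a_inj n x : a n x = 0 -> x = 0.
Proof.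
move=> ax; have [S bS [TS _]] := a_inv n.
by rewrite -(TS x) ax (linear_op0 bS.1).
Qed.

(** Since [a_n] and its adjoint are injective, the recurrence determines [u]
    from two consecutive terms, forwards and backwards. *)
Lemma recurrence_eq0 l u n :
  (forall k, formal_jacobi a b u k.+1 = l%:C *: u k.+1) ->
  u n = 0 -> u n.+1 = 0 -> forall k, u k = 0.
Proof.
move=> rec un un1.
have b0 k : b k 0 = 0 by rewrite (linear_op0 (b_selfadj k).1.1).
have a0 k : a k 0 = 0 by rewrite (linear_op0 (a_bounded k).1).
have c0 k : adj (a k) 0 = 0 by rewrite (linear_op0 (adja_bounded k).1).
have up k : u k = 0 -> u k.+1 = 0 -> u k.+2 = 0.
  move=> k0 k1; have := rec k; rewrite /= k0 k1 b0 c0 scaler0 !add0r.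
  exact: a_inj.
have down k : u k.+1 = 0 -> u k.+2 = 0 -> u k = 0.
  move=> k1 k2; have := rec k; rewrite /= k1 k2 b0 a0 scaler0 !addr0.
  exact: adja_inj.
have [z0 z1] : u 0 = 0 /\ u 1 = 0.
  elim: n un un1 => [//|n ih] un un1; apply: ih => //; exact: down.
move=> k; suff [] : u k = 0 /\ u k.+1 = 0 by [].
by elim: k => [//|k [ih1 ih2]]; split=> //; exact: up.
Qed.

Hypothesis weight_neq0 : forall n, w n != 0.
Hypothesis sum_a : (\sum_(1 <= n <oo)
       (opnorm (negpart (Reop ((alpha n.+1 \o adj (a n.+1))
                               - (adj (a n) \o conj_alpha a alpha n))))
        / weight a alpha n)%:E < +oo)%E.
Hypothesis sum_b : (\sum_(1 <= n <oo)
       (opnorm (conj_alpha a alpha n - alpha n) / weight a alpha n)%:E < +oo)%E.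
Hypothesis sum_c : (\sum_(1 <= n <oo)
       (opnorm ((alpha n \o b n.+1) - (b n \o conj_alpha a alpha n))
        / weight a alpha n)%:E < +oo)%E.
Hypothesis sum_d : (\sum_(0 <= n <oo) ((weight a alpha n)^-1)%:E = +oo)%E.

Lemma weight_gt0 n : 0 < w n.
Proof. by rewrite lt_neqAle eq_sym weight_neq0 weight_ge0. Qed.

Let step_defect_bound l : exists B, forall N, \sum_(1 <= n < N) step_defect l n / w n <= B.
Proof.
have w0 n : 0 <= (w n)^-1 by rewrite invr_ge0 weight_ge0.
have [|A hA] := nneseries_partial_bound _ sum_a.
  by move=> n; rewrite mulr_ge0// opnorm_ge0//; apply: negpart_bounded => //; exact: Reop_selfadjoint.
have [|B hB] := nneseries_partial_bound _ sum_b.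
  by move=> n; rewrite mulr_ge0// opnorm_ge0.
have [|C hC] := nneseries_partial_bound _ sum_c.
  by move=> n; rewrite mulr_ge0// opnorm_ge0.
exists (A + `|l| * B + C) => N; rewrite /step_defect.
under eq_bigr do rewrite !mulrDl -mulrA.
by rewrite !big_split/= -mulr_sumr !lerD// ler_wpM2l.
Qed.

(** The block form of [u] satisfies the hypotheses of [summable_vanish]. The
    equation is imposed on the rows [n >= 1], so that [u] may be an eigenvector
    as well as a solution of an equation with right-hand side supported at 0. *)
Lemma generalized_eigenvector_eq0 (l : R) (u : ell2 H) : Lambda a b alpha l ->
  (forall n, formal_jacobi a b u n.+1 = l%:C *: u n.+1) -> forall n, u n = 0.
Proof.
move=> Ll rec.
have [c [K [N [c0 K0 hcK]]]] := Lambda_block_form u weight_gt0 Ll.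
have [B hB] := step_defect_bound l.
have winf := @nneseries_partial_unbounded R (fun n => (w n)^-1) 0
  (fun n => ltac:(by rewrite /= invr_ge0 weight_ge0)) sum_d.
have eta0 n : 0 <= step_defect l n.
  by rewrite !addr_ge0 ?mulr_ge0 ?opnorm_ge0//; apply: negpart_bounded => //; exact: Reop_selfadjoint.
have [||||n [un un1]] := @summable_vanish R (fun n => rnorm (u n) ^+ 2) (block_form l u) w
  (step_defect l) c K (rnorm u ^+ 2) B N (fun n => sqr_ge0 _) weight_gt0 eta0 c0 K0 _ hB winf.
- by move=> M; rewrite big_mkord partial_le_rnorm.
- by move=> n /hcK /andP[].
- by move=> n /hcK /andP[].
- by move=> n _; exact: block_form_decrease.
by apply: (recurrence_eq0 rec) (rnorm_sqr_inj un) (rnorm_sqr_inj un1).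
Qed.

(** Otherwise [(A^* - l) u = f] has a square-summable solution for a nonzero
    [f] supported at 0; this [u] satisfies the homogeneous recurrence in all
    rows but the first, hence vanishes, and so does [f]. *)
Lemma Lambda_not_resolvent (l : R) : Lambda a b alpha l ->
  ~ resolvent_set (adj_graph (jacobi a b)) l%:C.
Proof.
move=> Ll [S bS SP].
have [h h0] : exists h : H, h != 0.
  apply: contrapT => /forallNP H0; have /eqP := weight_neq0 0; apply.
  apply/eqP; rewrite eq_le weight_ge0 andbT; apply: opnorm_le => // x.
  have /negP := H0 (alpha 0 (adj (a 0) x)); rewrite negbK => /eqP /= ->.
  by rewrite rnorm0 mul0r.
pose e n := if n is 0 then h else 0.
have e0 n : (1 <= n)%N -> e n = 0 by case: n.
pose f : ell2 H := Ell2 (fin_square_summable e0).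
have solve := adj_graph_jacobi a_bounded b_selfadj ((SP (S f) f).2 erefl).
have S0 n : S f n = 0.
  apply: (generalized_eigenvector_eq0 Ll) => k.
  by rewrite -solve -[LHS]/(0 + l%:C *: S f k.+1) add0r.
have : h + l%:C *: S f 0%N = formal_jacobi a b (S f) 0 by exact: solve 0%N.
rewrite /= S0 (S0 1%N) scaler0 addr0.
rewrite (linear_op0 (b_selfadj 0).1.1) (linear_op0 (a_bounded 0).1) addr0 => h00.
by move: h0; rewrite h00 eqxx.
Qed.

End GeneralizedEigenvectors.

(** * Absence of eigenvalues and location of the spectrum *)

Theorem theorem4 (R : realType) (H : hilbertType R)
    (a b alpha : nat -> H -> H)
    (a_bounded : forall n, bounded_op (a n))
    (a_inv : forall n, boundedly_invertible (a n))
    (b_selfadj : forall n, selfadjoint (b n))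
    (alpha_bounded : forall n, bounded_op (alpha n))
    (weight_neq0 : forall n, weight a alpha n != 0)
    (sum_a : (\sum_(1 <= n <oo)
       (opnorm (negpart (Reop ((alpha n.+1 \o adj (a n.+1))
                               - (adj (a n) \o conj_alpha a alpha n))))
        / weight a alpha n)%:E < +oo)%E)
    (sum_b : (\sum_(1 <= n <oo)
       (opnorm (conj_alpha a alpha n - alpha n) / weight a alpha n)%:E < +oo)%E)
    (sum_c : (\sum_(1 <= n <oo)
       (opnorm ((alpha n \o b n.+1) - (b n \o conj_alpha a alpha n))
        / weight a alpha n)%:E < +oo)%E)
    (sum_d : (\sum_(0 <= n <oo) ((weight a alpha n)^-1)%:E = +oo)%E) :
  point_spectrum (adj_graph (jacobi a b)) `&` [set l%:C | l in Lambda a b alpha]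
    = set0 /\
  [set l%:C | l in closure (Lambda a b alpha)]
    `<=` spectrum (adj_graph (jacobi a b)).
Proof.
split.
  rewrite -subset0 => z [[x x0 Gx] [l Ll lz]]; move/eqP: x0; apply.
  move: Gx; rewrite -lz => Gx.
  apply: val_inj; apply/funext => n /=.
  apply: (generalized_eigenvector_eq0 a_bounded a_inv b_selfadj alpha_bounded
    weight_neq0 sum_a sum_b sum_c sum_d Ll) => k.
  by rewrite -(adj_graph_jacobi a_bounded b_selfadj Gx).
move=> _ [l cl <-] res.
have cl2 := @ell2_seq_complete R H (hilbert_seq_complete (H := H)).
have [d d0 hd] := resolvent_set_open cl2 res.
have [l' [Ll' ball_l]] := cl _ (nbhsx_ballx l d d0).
apply: (Lambda_not_resolvent a_bounded a_inv b_selfadj alpha_bounded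
    weight_neq0 sum_a sum_b sum_c sum_d Ll').
apply: hd; rewrite -rmorphB /= expr0n addr0 sqrtr_sqr distrC.
exact: ball_l.
Qed.
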